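(* The second bounded cohomology of the group $\widehat{bV}$ with trivial real coefficients vanishes: $\mathrm{H}^2_b(\widehat{bV})=0$.
   Context: Trees and braids. A tree means a finite, rooted, planar, binary tree (possibly the trivial one-vertex tree); its leaves are numbered $1,\dots,n$ from left to right. A caret is a vertex together with two children. $B_n$ is the braid group on $n$ strands. Braids are drawn vertically, and the product $\beta\gamma$ is obtained by placing $\beta$ above $\gamma$. $\rho_n\colon B_n\to S_n$ is the standard projection: $\rho_n(\beta)(k)$ is the top position of the strand of $\beta$ starting at position $k$ at the bottom. The group $bV$. A representative triple is $(T_-,\beta,T_+)$ with $T_\pm$ trees having the same number $n$ of leaves and $\beta\in B_n$. For $1\le k\le n$ its $k$th expansion is $(T_-',\beta',T_+')$, where $T_+'$ is $T_+$ with a caret added at its $k$th leaf, $T_-'$ is $T_-$ with a caret added at its $\rho_n(\beta)(k)$th leaf, and $\beta'\in B_{n+1}$ is obtained from $\beta$ by bifurcating the $k$th strand (counting at the bottom) into two parallel strands. Let $[T_-,\beta,T_+]$ denote the class under the equivalence relation generated by expansion. The elements of the braided Thompson group $bV$ are these classes; any two elements can, after expansions, be written as $[T_-,\beta,T_+]$ and $[T_+,\gamma,U_+]$, and their product is $[T_-,\beta\gamma,U_+]$. The group $\widehat{bV}$. Let $\widehat{B}_n\le B_n$ be the standard copy of $B_{n-1}$ which only braids the first $n-1$ strands. $\widehat{bV}\le bV$ is the subgroup of all elements $[T_-,\beta,T_+]$ with $\beta\in\widehat{B}_n$ ($n$ the number of leaves of $T_\pm$); membership does not depend on the representative up to expansion.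 Bounded cohomology. $\mathrm{H}^\bullet_b(\Gamma)$ is the cohomology of the complex of bounded functions $\Gamma^n\to\mathbf{R}$ with $\delta^0=0$ and, for $n\ge 1$, $\delta^n f(g_1,\dots,g_{n+1})=f(g_2,\dots,g_{n+1})+\sum_{i=1}^n(-1)^if(g_1,\dots,g_ig_{i+1},\dots,g_{n+1})+(-1)^{n+1}f(g_1,\dots,g_n)$. *)

(* Defs.v *)
From Stdlib Require Import Relations.
From HB Require Import structures.
From mathcomp Require Import all_boot order perm ssralg ssrnum ring_quotient.
From mathcomp Require Import boolp functions reals.
From mathcomp Require Import ring lra zify.
From mathcomp Require Import generic_quotient.

Set Implicit Arguments.
Unset Strict Implicit.
Unset Printing Implicit Defensive.

Local Open Scope group_scope.
Local Open Scope quotient_scope.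

Section GeneratedEquivalence.
Variables (T : choiceType) (r : T -> T -> Prop).

Definition geneqv : rel T := fun x y => `[< clos_refl_sym_trans T r x y >].

Lemma geneqv_is_equiv : equiv_class_of geneqv.
Proof.
split=> [x|x y|y x z].
- exact/asboolP/rst_refl.
- by apply/asboolP/asboolP; apply: rst_sym.
- by move=> /asboolP xy /asboolP yz; apply/asboolP; apply: rst_trans xy yz.
Qed.

Canonical geneqv_equiv := EquivRelPack geneqv_is_equiv.
Canonical geneqv_encModRel := defaultEncModRel geneqv.

Definition genquot := {eq_quot geneqv}.

HB.instance Definition _ : EqQuotient T geneqv genquot := EqQuotient.on genquot.
HB.instance Definition _ := Choice.on genquot.

Lemma genquotP x y :
  clos_refl_sym_trans T r x y <-> \pi_genquot x = \pi_genquot y.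
Proof. by split=> [xy|/eqmodP/asboolP//]; apply/eqmodP/asboolP. Qed.

Lemma genquot_step x y : r x y -> \pi_genquot x = \pi_genquot y.
Proof. by move=> xy; apply/genquotP/rst_step. Qed.

Lemma genquot_lift (U : Type) (f : T -> U) :
    (forall x y, r x y -> f x = f y) ->
  forall x y, \pi_genquot x = \pi_genquot y -> f x = f y.
Proof. by move=> fE x y /genquotP; elim=> // {x y} [x y z _ -> _ ->]. Qed.

End GeneratedEquivalence.

(* Artin's presentation of the braid groups. The letter (i, e) stands for the
   crossing of the strands in positions i and i.+1 (numbered from 0) or, when e
   is false, for its inverse. Words are read from top to bottom, so that
   concatenation places its first argument above its second one. *)
Definition letter n := ('I_n.-1 * bool)%type.
Definition bword n := seq (letter n).

(* The two positions crossed by the letter of index i. *)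
Definition lo n (i : 'I_n.-1) : 'I_n := widen_ord (leq_pred n) i.
Fact hi_subproof n (i : 'I_n.-1) : i.+1 < n.
Proof. by case: n i => [|n] [i /=]; lia. Qed.
Definition hi n (i : 'I_n.-1) : 'I_n := Ordinal (hi_subproof i).

Inductive braid_rel n : bword n -> bword n -> Prop :=
| BraidInv (i : 'I_n.-1) e : braid_rel [:: (i, e); (i, ~~ e)] [::]
| BraidFar (i j : 'I_n.-1) of i.+1 < j :
    braid_rel [:: (i, true); (j, true)] [:: (j, true); (i, true)]
| BraidNear (i j : 'I_n.-1) of j = i.+1 :> nat :
    braid_rel [:: (i, true); (j, true); (i, true)]
              [:: (j, true); (i, true); (j, true)].

Inductive braid_step n : bword n -> bword n -> Prop :=
| BraidStep a (u v : bword n) b of braid_rel u v :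
    braid_step (a ++ u ++ b) (a ++ v ++ b).

Definition braid n := genquot (@braid_step n).
HB.instance Definition _ n := EqQuotient.on (braid n).
HB.instance Definition _ n := Choice.on (braid n).

Section BraidGroup.
Variable n : nat.
Implicit Types (u v w : bword n) (b c : braid n).

Definition word_inv w : bword n := [seq (l.1, ~~ l.2) | l <- rev w].

Definition braid1 : braid n := \pi_(braid n) [::].
Definition braid_mul b c : braid n := \pi_(braid n) (repr b ++ repr c).
Definition braid_inv b : braid n := \pi_(braid n) (word_inv (repr b)).

Lemma braid_piP u v :
  clos_refl_sym_trans _ (@braid_step n) u v <-> \pi_(braid n) u = \pi_(braid n) v.
Proof. exact: genquotP. Qed.

Lemma pi_ctx (a a' u v : bword n) : \pi_(braid n) u = \pi_(braid n) v ->
  \pi_(braid n) (a ++ u ++ a') = \pi_(braid n) (a ++ v ++ a').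
Proof.
apply: (@genquot_lift _ (@braid_step n) _ (fun u => \pi_(braid n) (a ++ u ++ a'))).
move=> _ _ [c x y d xy]; apply: genquot_step.
by rewrite -!catA !(catA a) ; constructor.
Qed.

Lemma pi_cat u v : \pi_(braid n) (u ++ v) = braid_mul (\pi u) (\pi v).
Proof.
rewrite /braid_mul.
have h w : \pi_(braid n) (repr (\pi_(braid n) w)) = \pi w by rewrite reprK.
have := pi_ctx (repr (\pi_(braid n) u)) [::] (h v); rewrite !cats0 => ->.
by have := pi_ctx [::] v (h u) => /= ->.
Qed.

Lemma braidW (P : braid n -> Prop) :
  (forall w, P (\pi w)) -> forall b, P b.
Proof. by move=> Pw b; rewrite -[b]reprK. Qed.

Lemma pi_rel u v : braid_rel u v -> \pi_(braid n) u = \pi_(braid n) v.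
Proof.
move=> uv; have := BraidStep [::] [::] uv; rewrite /= !cats0.
exact: genquot_step.
Qed.

Lemma braid_mulA : associative braid_mul.
Proof.
elim/braidW=> u; elim/braidW=> v; elim/braidW=> w.
by rewrite -!pi_cat catA.
Qed.

Lemma braid_mul1 : left_id braid1 braid_mul.
Proof. by elim/braidW=> u; rewrite -pi_cat. Qed.

Lemma braid_1mul : right_id braid1 braid_mul.
Proof. by elim/braidW=> u; rewrite -pi_cat cats0. Qed.

Lemma pi_word_mulV w : \pi_(braid n) (w ++ word_inv w) = braid1.
Proof.
elim: w => // -[i e] w IHw.
rewrite /word_inv rev_cons map_rcons -cats1 catA /= -cat1s pi_cat.
rewrite (pi_cat (w ++ _)) IHw braid_mul1 -pi_cat /=.
by apply: pi_rel; constructor.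
Qed.

Lemma word_invK : involutive word_inv.
Proof.
move=> w; rewrite /word_inv -map_rev revK -map_comp.
by rewrite map_id_in // => -[i e] _ /=; rewrite negbK.
Qed.

Lemma braid_mulV : right_inverse braid1 braid_inv braid_mul.
Proof.
by move=> b; rewrite -{1}[b]reprK /braid_inv -pi_cat pi_word_mulV.
Qed.

Lemma braid_Vmul : left_inverse braid1 braid_inv braid_mul.
Proof.
move=> b; rewrite -{2}[b]reprK /braid_inv -pi_cat -{2}[repr b]word_invK.
exact: pi_word_mulV.
Qed.

HB.instance Definition _ :=
  isGroup.Build (braid n) braid_mulA braid_mul1 braid_1mul braid_Vmul braid_mulV.

Lemma pi_catM u v : \pi_(braid n) (u ++ v) = \pi_(braid n) u * \pi_(braid n) v.
Proof. exact: pi_cat. Qed.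

Lemma pi_nil : \pi_(braid n) [::] = 1.
Proof. by []. Qed.

Lemma pi_inv w : \pi_(braid n) (word_inv w) = (\pi_(braid n) w)^-1.
Proof.
apply: (mulgI (\pi w : braid n)); rewrite mulgV -pi_catM; exact: pi_word_mulV.
Qed.

End BraidGroup.

(* rho_word w k is the top position of the strand starting at the bottom
   position k. The product s * t of permutations applies s first, whence the
   order of the factors (and rhoM below). *)
Fixpoint rho_word n (w : bword n) : {perm 'I_n} :=
  if w is l :: w' then rho_word w' * tperm (lo l.1) (hi l.1) else 1.

(* The crossing l after bifurcation of the strand starting at the bottom
   position k: when that strand is one of the two crossed, the other one crosses
   the two parallel copies in turn, with the same sign. A position p of B_n
   is also the index of a generator of B_(n+1), as n.+1.-1 = n. *)
Definition cable_letter n (k : 'I_n) (l : letter n) : bword n.+1 :=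
  let: (i, e) := l in
  if k < i then [:: (hi i, e)]
  else if k == lo i then [:: (lo i, e); (hi i, e)]
  else if k == hi i then [:: (hi i, e); (lo i, e)]
  else [:: (lo i, e)].

Fixpoint cable_word n (k : 'I_n) (w : bword n) : bword n.+1 :=
  if w is l :: w' then cable_letter (rho_word w' k) l ++ cable_word k w'
  else [::].

Definition rho n (b : braid n) : {perm 'I_n} := rho_word (repr b).

Definition cable n (b : braid n) (k : 'I_n) : braid n.+1 :=
  \pi_(braid n.+1) (cable_word k (repr b)).

(* The same operations on raw indices, for case analysis. *)
Definition nletter n (l : letter n) : nat * bool := (nat_of_ord l.1, l.2).
Definition nword n (w : bword n) := [seq nletter l | l <- w].

Definition nswap i k := if k == i then i.+1 else if k == i.+1 then i else k.

Fixpoint nrho (w : seq (nat * bool)) k :=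
  if w is l :: w' then nswap l.1 (nrho w' k) else k.

Definition ncable_letter k (l : nat * bool) : seq (nat * bool) :=
  let: (i, e) := l in
  if k < i then [:: (i.+1, e)]
  else if k == i then [:: (i, e); (i.+1, e)]
  else if k == i.+1 then [:: (i.+1, e); (i, e)]
  else [:: (i, e)].

Fixpoint ncable k (w : seq (nat * bool)) :=
  if w is l :: w' then ncable_letter (nrho w' k) l ++ ncable k w' else [::].

Lemma rho_word_cons n (l : letter n) w k :
  rho_word (l :: w) k = tperm (lo l.1) (hi l.1) (rho_word w k).
Proof. by rewrite /= permM. Qed.

Lemma val_tperm n (i : 'I_n.-1) (k : 'I_n) :
  tperm (lo i) (hi i) k = nswap i k :> nat.
Proof.
rewrite /nswap; case: tpermP => [->|->|] /=; rewrite ?eqxx //.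
  by case: ifP => [/eqP|//]; lia.
move=> /eqP; rewrite -val_eqE /= => /negPf-> /eqP; rewrite -val_eqE /=.
by move/negPf->.
Qed.

Lemma val_rho_word n (w : bword n) k : rho_word w k = nrho (nword w) k :> nat.
Proof.
elim: w k => [|l w IHw] k; first by rewrite /= perm1.
by rewrite rho_word_cons /= val_tperm IHw.
Qed.

Lemma nword_cable_letter n (k : 'I_n) l :
  nword (cable_letter k l) = ncable_letter k (nletter l).
Proof.
case: l => i e; rewrite /cable_letter /ncable_letter /= -!val_eqE /=.
by do !case: ifP.
Qed.

Lemma nword_cable n (w : bword n) k : nword (cable_word k w) = ncable k (nword w).
Proof.
elim: w => //= l w IHw.
rewrite /nword map_cat -!/(nword _) -/(nword (cable_word k w)).
by rewrite nword_cable_letter val_rho_word IHw.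
Qed.

(* The generator of index i, or 1 when i is out of range. *)
Definition sig n i : braid n :=
  if insub i is Some j then \pi_(braid n) [:: (j : 'I_n.-1, true)] else 1.

Definition sige n i (e : bool) : braid n := if e then sig n i else (sig n i)^-1.

Definition nbraid n (w : seq (nat * bool)) : braid n :=
  foldr (fun l b => sige n l.1 l.2 * b) 1 w.

Lemma nbraid_cat n u v : nbraid n (u ++ v) = nbraid n u * nbraid n v.
Proof. by elim: u => [|l u IHu] /=; rewrite ?mul1g // IHu mulgA. Qed.

Lemma sigeE n (l : letter n) : \pi_(braid n) [:: l] = sige n l.1 l.2.
Proof.
case: l => i e /=; rewrite /sige /sig valK.
case: e => //; rewrite -pi_inv //.
Qed.

Lemma pi_nword n (w : bword n) : \pi_(braid n) w = nbraid n (nword w).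
Proof. by elim: w => // l w IHw; rewrite -cat1s pi_catM IHw sigeE. Qed.

Lemma sig_far n i j : i.+1 < j -> commute (sig n i) (sig n j).
Proof.
rewrite /sig /commute => ij.
case: insubP => [i' _ iE|]; last by rewrite mul1g mulg1.
case: insubP => [j' _ jE|]; last by rewrite mul1g mulg1.
by rewrite -!pi_catM; apply/pi_rel; apply: BraidFar; rewrite iE jE.
Qed.

Lemma sig_near n i : i.+1 < n.-1 ->
  sig n i * sig n i.+1 * sig n i = sig n i.+1 * sig n i * sig n i.+1.
Proof.
move=> lt_in; have lt_in' : i < n.-1 by lia.
rewrite /sig !insubT -!pi_catM; apply: pi_rel.
by apply: (@BraidNear _ (Ordinal lt_in') (Ordinal lt_in)).
Qed.

Lemma sige_far n i j e f : i.+1 < j -> commute (sige n i e) (sige n j f).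
Proof.
move=> ij; have := sig_far n ij; rewrite /sige => C.
case: e f => [] [] //; first exact: commuteV.
  exact/commute_sym/commuteV/commute_sym.
exact/commuteV/commute_sym/commuteV/commute_sym.
Qed.

Lemma sige_farC n i j e f x : i.+1 < j ->
  sige n i e * (sige n j f * x) = sige n j f * (sige n i e * x).
Proof. by move=> /(sige_far n e f) C; rewrite !mulgA C. Qed.

Lemma sig_farC n i j x : i.+1 < j ->
  sig n i * (sig n j * x) = sig n j * (sig n i * x).
Proof. by move=> /(sig_far n) C; rewrite !mulgA C. Qed.

Lemma sig_nearC n i x : i.+1 < n.-1 ->
  sig n i * (sig n i.+1 * (sig n i * x)) =
  sig n i.+1 * (sig n i * (sig n i.+1 * x)).
Proof. by move=> /sig_near E; rewrite !mulgA E. Qed.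

Lemma sigeKV n i e x : sige n i e * (sige n i (~~ e) * x) = x.
Proof. by case: e => /=; rewrite ?mulKg ?mulVKg. Qed.

Lemma rho_word_cat n (u v : bword n) : rho_word (u ++ v) = rho_word v * rho_word u.
Proof. by elim: u => [|l u IHu] /=; rewrite ?mulg1 // IHu mulgA. Qed.

Lemma cable_word_cat n (u v : bword n) k :
  cable_word k (u ++ v) = cable_word (rho_word v k) u ++ cable_word k v.
Proof. by elim: u => //= l u ->; rewrite rho_word_cat permM catA. Qed.

Lemma rho_word_rel n (u v : bword n) : braid_rel u v -> rho_word u = rho_word v.
Proof.
move=> uv; apply/permP=> k; apply: val_inj; rewrite /= !val_rho_word.
case: uv => [i e|i j ij|i j ij] /=; rewrite /nswap;
  by do !(case: ifP); lia.
Qed.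

Ltac ifs1 :=
  match goal with
  | |- context [if ?b then _ else _] =>
    match b with
    | context [if _ then _ else _] => fail 1
    | _ => let H := fresh "H" in
           case H: b; rewrite /=
    end
  end.
Ltac ifs := repeat (ifs1; try (exfalso; lia)).
Ltac nifs := repeat (ifs1; rewrite /nswap /=; try (exfalso; lia)).

Lemma cable_word_rel n (u v : bword n) k : braid_rel u v ->
  \pi_(braid n.+1) (cable_word k u) = \pi_(braid n.+1) (cable_word k v).
Proof.
move=> uv; rewrite !pi_nword !nword_cable.
case: uv => [i e|i j ij|i j ij] /=; rewrite /nswap.
- move: (nat_of_ord i) (nat_of_ord k) => {}i {}k.
  by ifs; rewrite ?sigeKV ?mulg1 ?mulgV.
- move: (nat_of_ord i) (nat_of_ord j) (nat_of_ord k) ij => {}i {}j {}k ij.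
  have C1 x := @sig_farC n.+1 i j x ij.
  have C2 x : sig n.+1 i * (sig n.+1 j.+1 * x) = sig n.+1 j.+1 * (sig n.+1 i * x).
    by apply: sig_farC; lia.
  have C3 x : sig n.+1 i.+1 * (sig n.+1 j.+1 * x)
            = sig n.+1 j.+1 * (sig n.+1 i.+1 * x) by exact: sig_farC.
  have [ij'|ij'] := ltnP i.+2 j.
    have C4 x := @sig_farC n.+1 i.+1 j x ij'.
    by ifs; rewrite /sige; do 4 rewrite ?C1 ?C2 ?C3 ?C4.
  have E : j = i.+2 by lia.
  by subst j; ifs; rewrite /sige; do 4 rewrite ?C1 ?C2 ?C3.
- have jn := ltn_ord j.
  move: (nat_of_ord i) (nat_of_ord j) (nat_of_ord k) ij jn => {}i {}j {}k -> jn.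
  have N1 x : sig n.+1 i * (sig n.+1 i.+1 * (sig n.+1 i * x)) =
    sig n.+1 i.+1 * (sig n.+1 i * (sig n.+1 i.+1 * x)) by apply: sig_nearC; lia.
  have N2 x : sig n.+1 i.+1 * (sig n.+1 i.+2 * (sig n.+1 i.+1 * x)) =
    sig n.+1 i.+2 * (sig n.+1 i.+1 * (sig n.+1 i.+2 * x)) by apply: sig_nearC; lia.
  have C x : sig n.+1 i * (sig n.+1 i.+2 * x) = sig n.+1 i.+2 * (sig n.+1 i * x).
    exact: sig_farC.
  ifs; rewrite /sige //.
  + by rewrite -C N1 N2 C.
  + by rewrite N2 C -(C 1) N1.
  + by rewrite C N1 N2 -C.
Qed.

Lemma rho_pi n (w : bword n) : rho (\pi_(braid n) w) = rho_word w.
Proof.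
apply: (@genquot_lift _ (@braid_step n) _ (@rho_word n)); last by rewrite reprK.
by move=> _ _ [a u v b /rho_word_rel uv]; rewrite !rho_word_cat uv.
Qed.

Lemma cable_pi n (w : bword n) k :
  cable (\pi_(braid n) w) k = \pi_(braid n.+1) (cable_word k w).
Proof.
apply: (@genquot_lift _ (@braid_step n) _
  (fun w => \pi_(braid n.+1) (cable_word k w))); last by rewrite reprK.
move=> _ _ [a u v b uv]; rewrite !cable_word_cat !rho_word_cat !pi_catM.
by rewrite (cable_word_rel _ uv) (rho_word_rel uv).
Qed.

Lemma rho1 n : rho (1 : braid n) = 1.
Proof. by rewrite -pi_nil rho_pi. Qed.

Lemma rhoM n (b c : braid n) : rho (b * c) = rho c * rho b.
Proof.
elim/braidW: b => u; elim/braidW: c => v.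
by rewrite -pi_catM !rho_pi rho_word_cat.
Qed.

Lemma rhoV n (b : braid n) : rho b^-1 = (rho b)^-1.
Proof. by apply: (mulgI (rho b)); rewrite -rhoM mulVg rho1 mulgV. Qed.

Lemma cable1 n k : cable (1 : braid n) k = 1.
Proof. by rewrite -pi_nil cable_pi. Qed.

Lemma cableM n (b c : braid n) k :
  cable (b * c) k = cable b (rho c k) * cable c k.
Proof.
elim/braidW: b => u; elim/braidW: c => v.
by rewrite -pi_catM rho_pi !cable_pi cable_word_cat pi_catM.
Qed.

Lemma cableV n (b : braid n) k : cable b^-1 (rho b k) = (cable b k)^-1.
Proof. by apply: (mulIg (cable b k)); rewrite -cableM !mulVg cable1. Qed.

(* The position of l after the strand k != l has been doubled. *)
Definition shift n (k l : 'I_n) : 'I_n.+1 := lift (widen_ord (leqnSn n) k) l.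

Lemma nrho_inj w : injective (nrho w).
Proof.
elim: w => //= l w IHw i j H; apply: IHw; move: H; rewrite /nswap.
by move: (nrho w i) (nrho w j) => x y; ifs; lia.
Qed.

Lemma nrho_cat u v k : nrho (u ++ v) k = nrho u (nrho v k).
Proof. by elim: u => //= l u ->. Qed.

Lemma ncable_cat u v k : ncable k (u ++ v) = ncable (nrho v k) u ++ ncable k v.
Proof. by elim: u => //= l u ->; rewrite nrho_cat catA. Qed.

Lemma nrho_cable w a c : a != c ->
  nrho (ncable a w) (bump a c) = bump (nrho w a) (nrho w c).
Proof.
elim: w => //= -[i e] w IHw ac /=.
rewrite nrho_cat IHw //.
have : nrho w a != nrho w c by apply: contra_neq ac => /nrho_inj.
move: (nrho w a) (nrho w c) => {IHw ac}x y xy; rewrite /bump.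
have [lexy|ltyx] := leqP x y; rewrite ?add0n ?add1n.
  by ifs; rewrite /nswap /=; ifs; lia.
by ifs; rewrite /nswap /=; ifs; lia.
Qed.

Lemma ncable_letterC n a c l : a != c ->
  nbraid n (ncable (bump a c) (ncable_letter a l)) =
  nbraid n (ncable (bump c a) (ncable_letter c l)).
Proof.
case: l => i e; wlog ac : a c / a < c => [th|_] /=.
  rewrite neq_ltn => /orP[] ac; first by apply: th => //; rewrite neq_ltn ac.
  by apply/esym/th => //; rewrite neq_ltn ac.
have -> : bump a c = c.+1 by rewrite /bump; lia.
have -> : bump c a = a by rewrite /bump; lia.
have C x : sige n i e * (sige n i.+2 e * x) = sige n i.+2 e * (sige n i e * x).
  exact: sige_farC.
by nifs; rewrite ?C.
Qed.

Lemma ncableC n w a c : a != c ->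
  nbraid n (ncable (bump a c) (ncable a w)) =
  nbraid n (ncable (bump c a) (ncable c w)).
Proof.
move=> ac; have ca : c != a by rewrite eq_sym.
elim: w => //= l w IHw.
rewrite !ncable_cat !nbraid_cat IHw !nrho_cable // ncable_letterC //.
by apply: contra_neq ac => /nrho_inj.
Qed.

Lemma rho_cable n (b : braid n) k l : k != l ->
  rho (cable b k) (shift k l) = shift (rho b k) (rho b l).
Proof.
move=> kl; elim/braidW: b => w; rewrite cable_pi !rho_pi.
by apply: val_inj; rewrite /= !val_rho_word nword_cable nrho_cable.
Qed.

Lemma cableC n (b : braid n) k l : k != l ->
  cable (cable b k) (shift k l) = cable (cable b l) (shift l k).
Proof.
move=> kl; elim/braidW: b => w.
by rewrite !cable_pi !pi_nword !nword_cable ncableC.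
Qed.

Inductive tree := Leaf | Caret of tree & tree.

Fixpoint nleaves t := if t is Caret t1 t2 then nleaves t1 + nleaves t2 else 1%N.

(* The tree t with a caret added at its leaf of index k (leaves are numbered
   from 0, left to right). *)
Fixpoint add_caret t k :=
  match t with
  | Leaf => Caret Leaf Leaf
  | Caret t1 t2 => if k < nleaves t1 then Caret (add_caret t1 k) t2
                   else Caret t1 (add_caret t2 (k - nleaves t1))
  end.

Lemma nleaves_gt0 t : 0 < nleaves t.
Proof. by elim: t => //= t1 h1 t2 h2; lia. Qed.

Lemma nleaves_add_caret t k : nleaves (add_caret t k) = (nleaves t).+1.
Proof. by elim: t k => //= t1 h1 t2 h2 k; case: ifP; rewrite /= ?h1 ?h2; lia. Qed.

Definition treeN n := {t : tree | nleaves t == n}.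

Fact treeN_caret_subproof n (t : treeN n) (k : 'I_n) :
  nleaves (add_caret (val t) k) == n.+1.
Proof. by rewrite nleaves_add_caret (eqP (valP t)). Qed.

Definition caret_at n (t : treeN n) (k : 'I_n) : treeN n.+1 :=
  Sub (add_caret (val t) k) (treeN_caret_subproof t k).

Fixpoint tle s t :=
  match s, t with
  | Leaf, _ => true
  | Caret s1 s2, Caret t1 t2 => tle s1 t1 && tle s2 t2
  | Caret _ _, Leaf => false
  end.

Fixpoint tjoin s t :=
  match s, t with
  | Leaf, _ => t
  | _, Leaf => s
  | Caret s1 s2, Caret t1 t2 => Caret (tjoin s1 t1) (tjoin s2 t2)
  end.

Lemma tle_refl t : tle t t. Proof. by elim: t => //= t1 -> t2 ->. Qed.

Lemma tle_joinl s t : tle s (tjoin s t).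
Proof.
by elim: s t => [|s1 h1 s2 h2] [|t1 t2] //=; rewrite ?tle_refl ?h1 ?h2.
Qed.

Lemma tle_joinr s t : tle t (tjoin s t).
Proof.
by elim: s t => [|s1 h1 s2 h2] [|t1 t2] //=; rewrite ?tle_refl ?h1 ?h2.
Qed.

Lemma tle_trans : transitive tle.
Proof.
by elim=> [|t1 h1 t2 h2] [|s1 s2] [|u1 u2] //= /andP[/h1 h /h2 h'] /andP[/h-> /h'->].
Qed.

Lemma tle_add_caret t k : tle t (add_caret t k).
Proof.
elim: t k => //= t1 h1 t2 h2 k; case: ifP => _ /=; rewrite ?h1 ?h2 ?tle_refl //.
Qed.

Lemma tle_nleaves s t : tle s t -> nleaves s <= nleaves t.
Proof.
elim: s t => [|s1 h1 s2 h2] [|t1 t2] //=; first by have := nleaves_gt0 t1; lia.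
by move=> /andP[/h1 + /h2]; lia.
Qed.

Lemma tle_eq s t : tle s t -> nleaves s = nleaves t -> s = t.
Proof.
elim: s t => [|s1 h1 s2 h2] [|t1 t2] //=.
  by have := nleaves_gt0 t1; have := nleaves_gt0 t2; lia.
move=> /andP[st1 st2]; have l1 := tle_nleaves st1; have l2 := tle_nleaves st2.
by move=> E; congr Caret; [apply: h1|apply: h2] => //; lia.
Qed.

Lemma tle_add s t : tle s t -> nleaves s < nleaves t ->
  exists2 k, k < nleaves s & tle (add_caret s k) t.
Proof.
elim: s t => [|s1 h1 s2 h2] [|t1 t2] //=; first by exists 0%N.
move=> /andP[st1 st2]; have l1 := tle_nleaves st1; have l2 := tle_nleaves st2.
have [lt1 _|le1 lt12] := ltnP (nleaves s1) (nleaves t1).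
  have [k kn kP] := h1 _ st1 lt1; exists k; first by lia.
  by rewrite kn /= kP.
have [||k kn kP] := h2 t2 _ _; [by []|by lia|].
exists (nleaves s1 + k)%N; first by lia.
by rewrite ltnNge leq_addr /= addKn st1.
Qed.

Lemma tle_add2 s t a c : a != c -> a < nleaves s -> c < nleaves s ->
  tle (add_caret s a) t -> tle (add_caret s c) t ->
  tle (add_caret (add_caret s a) (bump a c)) t.
Proof.
elim: s t a c => [|s1 h1 s2 h2] [|t1 t2] a c //=; first by case: a c => [|a] [|c].
  by case: ifP.
move=> ac al cl; case: ifP => a1 /=; case: ifP => c1 /=;
  move=> /andP[A1 A2] /andP[C1 C2].
- rewrite nleaves_add_caret ifT /=; last by rewrite /bump; lia.
  by rewrite A2 andbT h1.
- rewrite nleaves_add_caret ifF /=; last by rewrite /bump; lia.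
  have -> : (bump a c - (nleaves s1).+1 = c - nleaves s1)%N by rewrite /bump; lia.
  by rewrite A1.
- have -> : bump a c = c by rewrite /bump; lia.
  by rewrite c1 /= C1 A2.
- rewrite ifF /=; last by rewrite /bump; lia.
  have -> : (bump a c - nleaves s1 = bump (a - nleaves s1) (c - nleaves s1))%N.
    by rewrite /bump; lia.
  by rewrite A1 h2 //; lia.
Qed.

Lemma add_caretC t a c : a != c -> a < nleaves t -> c < nleaves t ->
  add_caret (add_caret t a) (bump a c) = add_caret (add_caret t c) (bump c a).
Proof.
elim: t a c => [|t1 h1 t2 h2] a c /=; first by case: a c => [|a] [|c].
move=> ac al cl.
case: (ltnP a (nleaves t1)) => a1; case: (ltnP c (nleaves t1)) => c1 /=.
- rewrite !nleaves_add_caret !ifT; [|rewrite /bump; lia|rewrite /bump; lia].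
  by congr Caret; apply: h1.
- rewrite !nleaves_add_caret ifF ?ifT /bump; try lia.
  by congr (Caret (add_caret _ _) (add_caret _ _)); lia.
- rewrite !nleaves_add_caret ifT ?ifF /bump; try lia.
  by congr (Caret (add_caret _ _) (add_caret _ _)); lia.
- rewrite !ifF /bump; try lia.
  have := h2 (a - nleaves t1)%N (c - nleaves t1)%N; rewrite /bump => h.
  congr Caret.
  have -> : ((a <= c) + c - nleaves t1 =
    (a - nleaves t1 <= c - nleaves t1) + (c - nleaves t1))%N by lia.
  have -> : ((c <= a) + a - nleaves t1 =
    (c - nleaves t1 <= a - nleaves t1) + (a - nleaves t1))%N by lia.
  by apply: h; lia.
Qed.

(* (T_-, beta, T_+) *)
Record triple := Triple {
  nstrands : nat;
  tminus : treeN nstrands;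
  tbraid : braid nstrands;
  tplus : treeN nstrands }.

HB.instance Definition _ := gen_eqMixin triple.
HB.instance Definition _ := gen_choiceMixin triple.

Definition expansion (x : triple) (k : 'I_(nstrands x)) : triple :=
  Triple (caret_at (tminus x) (rho (tbraid x) k)) (cable (tbraid x) k)
         (caret_at (tplus x) k).

Arguments expansion : clear implicits.

Definition expands (x y : triple) : Prop := exists k, y = expansion x k.

Definition bV := genquot expands.
HB.instance Definition _ := EqQuotient.on bV.
HB.instance Definition _ := Choice.on bV.

Definition xexp := clos_refl_trans_1n triple expands.
Definition rtm (x : triple) : tree := val (tminus x).
Definition rtp (x : triple) : tree := val (tplus x).

Lemma nleaves_rtp x : nleaves (rtp x) = nstrands x.
Proof. exact: (eqP (valP (tplus x))). Qed.
Lemma nleaves_rtm x : nleaves (rtm x) = nstrands x.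
Proof. exact: (eqP (valP (tminus x))). Qed.

Definition triple_inv (x : triple) : triple :=
  Triple (tplus x) (tbraid x)^-1 (tminus x).

Lemma triple_invK : involutive triple_inv.
Proof. by case=> n T b V; rewrite /triple_inv /= invgK. Qed.

Lemma expands_inv x y : expands x y -> expands (triple_inv x) (triple_inv y).
Proof.
case: x => n T b V [/= k ->].
exists (rho b k : 'I_(nstrands (triple_inv (Triple T b V)))).
by rewrite /expansion /triple_inv /= cableV rhoV permK.
Qed.

Lemma xexp_refl x : xexp x x. Proof. exact: rt1n_refl. Qed.

Lemma xexp1 x y : expands x y -> xexp x y.
Proof. by move=> xy; apply: Relation_Operators.rt1n_trans xy _; apply: rt1n_refl. Qed.

Lemma xexp_trans x y z : xexp x y -> xexp y z -> xexp x z.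
Proof.
by elim=> // {}x w {}y xw _ IH /IH; apply: Relation_Operators.rt1n_trans.
Qed.

Lemma xexp_inv x y : xexp x y -> xexp (triple_inv x) (triple_inv y).
Proof.
elim=> [{}x|{}x w {}y xw _ IH]; first exact: xexp_refl.
exact/xexp_trans/IH/xexp1/expands_inv.
Qed.

Lemma xexp_pi x y : xexp x y -> \pi_bV x = \pi_bV y.
Proof. by elim=> // {}x w {}y xw _ <-; apply: genquot_step. Qed.

Lemma xexp_tle x y : xexp x y -> tle (rtp x) (rtp y).
Proof.
elim=> [{}x|{}x w {}y [k ->] _]; first exact: tle_refl.
exact/tle_trans/tle_add_caret.
Qed.

Lemma expansionC x k l : k != l ->
  expansion (expansion x k) (shift k l) = expansion (expansion x l) (shift l k).
Proof.
case: x k l => n T b V /= k l kl; have lk : l != k by rewrite eq_sym.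
rewrite /expansion /= cableC // !rho_cable //.
have bkl : rho b k != rho b l by rewrite (inj_eq perm_inj).
have hT := eqP (valP T); have hV := eqP (valP V).
by congr Triple; apply: val_inj; apply: add_caretC; rewrite ?hT ?hV.
Qed.

Lemma xexp_ex x t : tle (rtp x) t -> exists2 y, xexp x y & rtp y = t.
Proof.
have [d] := ubnP (nleaves t - nstrands x); elim: d x => // d IHd x ltd xt.
have := tle_nleaves xt; rewrite nleaves_rtp leq_eqVlt => /predU1P[E|lt_xt].
  by exists x; [exact: xexp_refl|apply: tle_eq; rewrite ?nleaves_rtp].
have [|k] := tle_add xt; first by rewrite nleaves_rtp.
rewrite nleaves_rtp => kn kt.
have [||y xy yt] := IHd (expansion x (Ordinal kn)); rewrite ?[nstrands _]/=;
  [lia|by []|].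
by exists y => //; apply: xexp_trans xy; apply: xexp1; exists (Ordinal kn).
Qed.

Lemma xexp_uniq x y y' : xexp x y -> xexp x y' -> rtp y = rtp y' -> y = y'.
Proof.
have [d] := ubnP (nstrands y - nstrands x).
elim: d x y y' => // d IHd x y y' ltd xy xy' yy'.
have := tle_nleaves (xexp_tle xy); rewrite !nleaves_rtp => le_xy.
case: xy xy' yy' ltd le_xy => [|z w [k ->] zw].
  case=> // w z [k ->] wz E _ _; have := tle_nleaves (xexp_tle wz).
  by rewrite -E !nleaves_rtp /= ltnn.
case=> [E|v u [l ->] vu wu] ltd _.
  by have := tle_nleaves (xexp_tle zw); rewrite E !nleaves_rtp /= ltnn.
have /= lew := tle_nleaves (xexp_tle zw); rewrite !nleaves_rtp /= in lew.
have [kl|kl] := eqVneq k l.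
  by apply: IHd zw _ wu => /=; rewrite ?kl //; lia.
pose a := expansion (expansion x k) (shift k l).
have [|c ac cw] := @xexp_ex a (rtp w).
  apply: tle_add2; rewrite ?nleaves_rtp //.
    exact: xexp_tle zw.
  by rewrite wu; exact: xexp_tle vu.
have c1 : w = c.
  apply: IHd zw _ _ => /=; [lia| |by []].
  by apply: xexp_trans ac; apply: xexp1; exists (shift k l).
have c2 : c = u; last by rewrite c1 c2.
have En : nstrands c = nstrands w by rewrite -!nleaves_rtp cw.
apply: (IHd (expansion x l)); rewrite ?cw //=; first lia.
apply: xexp_trans ac; apply: xexp1; exists (shift l k).
by rewrite /a expansionC.
Qed.

Lemma pi_xexp x y : \pi_bV x = \pi_bV y -> exists2 z, xexp x z & xexp y z.
Proof.
move=> /genquotP; elim=> {x y} [x y xy|x|x y _ [z zx zy]|x y z _ [u xu yu] _ [v yv zv]].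
- by exists y; [exact: xexp1|exact: xexp_refl].
- by exists x; exact: xexp_refl.
- by exists z.
have [u' uu' u'E] := xexp_ex (tle_joinl (rtp u) (rtp v)).
have [v' vv' v'E] := xexp_ex (tle_joinr (rtp u) (rtp v)).
have E : u' = v'.
  by apply: (@xexp_uniq y); [exact: xexp_trans uu'|exact: xexp_trans vv'|rewrite u'E].
by exists u'; [exact: xexp_trans uu'|rewrite E; exact: xexp_trans vv'].
Qed.

Lemma xexp_exm x t : tle (rtm x) t -> exists2 y, xexp x y & rtm y = t.
Proof.
move=> xt; have [y xy yt] := @xexp_ex (triple_inv x) t xt.
by exists (triple_inv y) => //; rewrite -[x]triple_invK; exact: xexp_inv.
Qed.

Lemma xexp_uniqm x y y' : xexp x y -> xexp x y' -> rtm y = rtm y' -> y = y'.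
Proof.
move=> /xexp_inv xy /xexp_inv xy' E.
by apply: (can_inj triple_invK); exact: xexp_uniq xy xy' E.
Qed.

Lemma xexp_mul n (T V U : treeN n) b c m (T' V' : treeN m) b' :
  xexp (Triple T b V) (Triple T' b' V') ->
  exists U' c', xexp (Triple V c U) (Triple V' c' U') /\
     xexp (Triple T (b * c) U) (Triple T' (b' * c') U').
Proof.
move=> xy; pose P (x y : triple) := forall (U : treeN (nstrands x)) c,
  exists U' c', xexp (Triple (tplus x) c U) (Triple (tplus y) c' U') /\
     xexp (Triple (tminus x) (tbraid x * c) U) (Triple (tminus y) (tbraid y * c') U').
suff: P (Triple T b V) (Triple T' b' V') by apply.
elim: xy => {n T b V m T' V' b' U c} [x|x y z [k ->] _ IH] U c.
  by exists U, c; split; exact: xexp_refl.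
pose l := (rho c)^-1 k; have kE : rho c l = k by rewrite /l permKV.
have [U' [c' [h1 h2]]] := IH (caret_at U l) (cable c l).
exists U', c'; split.
  apply: xexp_trans h1; apply: xexp1; exists (l : 'I_(nstrands (Triple (tplus x) c U))).
  by rewrite /expansion /= kE.
apply: xexp_trans h2; apply: xexp1.
exists (l : 'I_(nstrands (Triple (tminus x) (tbraid x * c) U))).
by rewrite /expansion /= cableM rhoM permM kE.
Qed.


Lemma triple_inj n (T V T' V' : treeN n) b b' :
  Triple T b V = Triple T' b' V' -> [/\ T = T', b = b' & V = V'].
Proof.
pose f x := existT (fun n => treeN n * braid n * treeN n)%type
  (nstrands x) (tminus x, tbraid x, tplus x).
move=> /(congr1 f)/(Eqdep_dec.inj_pair2_eq_dec _ PeanoNat.Nat.eq_dec _ _ _ _) /=.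
by case.
Qed.

Lemma bVW (P : bV -> Prop) :
  (forall n (T V : treeN n) b, P (\pi_bV (Triple T b V))) -> forall x, P x.
Proof. by move=> PT x; rewrite -[x]reprK; case: (repr x) => n T b V. Qed.

Lemma triple_match x m (V : treeN m) : rtm x = val V ->
  exists c U, x = Triple V c U.
Proof.
case: x => n T c U; rewrite /rtm /= => E.
have nm : n = m by have := eqP (valP T); have := eqP (valP V); rewrite [val T]E => -> ->.
by subst m; exists c, U; rewrite (_ : T = V) //; apply: val_inj.
Qed.

Lemma triple_matchp x m (V : treeN m) : rtp x = val V ->
  exists T b, x = Triple T b V.
Proof.
case: x => n T c U; rewrite /rtp /= => E.
have nm : n = m by have := eqP (valP U); have := eqP (valP V); rewrite [val U]E => -> ->.
by subst m; exists T, c; rewrite (_ : U = V) //; apply: val_inj.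
Qed.

(* bV_prod x y z holds when z is the product of x and y computed on some
   composable representatives. *)
Inductive bV_prod : bV -> bV -> bV -> Prop :=
| BVProd n (T V U : treeN n) b c :
    bV_prod (\pi_bV (Triple T b V)) (\pi_bV (Triple V c U))
          (\pi_bV (Triple T (b * c) U)).

Lemma bV_prodP x y z : bV_prod x y z ->
  exists n (T V U : treeN n) b c,
    [/\ x = \pi_bV (Triple T b V), y = \pi_bV (Triple V c U)
      & z = \pi_bV (Triple T (b * c) U)].
Proof. by case=> n T V U b c; exists n, T, V, U, b, c. Qed.

Lemma composable (x y : triple) : exists n (T V U : treeN n) b c,
  xexp x (Triple T b V) /\ xexp y (Triple V c U).
Proof.
have [x' xx' x'E] := xexp_ex (tle_joinl (rtp x) (rtm y)).
have [y' yy' y'E] := xexp_exm (tle_joinr (rtp x) (rtm y)).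
case: x' xx' x'E => n T b V xx' x'E.
have [|c [U yE]] := @triple_match y' n V; first by rewrite y'E -x'E.
by exists n, T, V, U, b, c; rewrite -yE.
Qed.

Lemma bV_prod_ex x y : exists z, bV_prod x y z.
Proof.
rewrite -[x]reprK -[y]reprK.
have [n [T [V [U [b [c [/xexp_pi-> /xexp_pi->]]]]]]] := composable (repr x) (repr y).
by exists (\pi_bV (Triple T (b * c) U)); constructor.
Qed.

Lemma bV_prod_uniq x y z z' : bV_prod x y z -> bV_prod x y z' -> z = z'.
Proof.
suff H n (T V U : treeN n) b c m (T' V' U' : treeN m) b' c' :
    \pi_bV (Triple T b V) = \pi_bV (Triple T' b' V') ->
    \pi_bV (Triple V c U) = \pi_bV (Triple V' c' U') ->
    \pi_bV (Triple T (b * c) U) = \pi_bV (Triple T' (b' * c') U').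
  case/bV_prodP=> n [T [V [U [b [c [-> -> ->]]]]]].
  by case/bV_prodP=> m [T' [V' [U' [b' [c' []]]]]] xE yE ->; exact: H xE yE.
move=> {x y z z'} /pi_xexp[x xx xx'] /pi_xexp[y yy yy'].
have [k [T2 [V2 [U2 [b2 [c2 [hx hy]]]]]]] := composable x y.
have [U3 [c3 [h1 h2]]] := @xexp_mul _ T V U b c _ _ _ _ (xexp_trans xx hx).
have [U4 [c4 [h3 h4]]] := @xexp_mul _ T' V' U' b' c' _ _ _ _ (xexp_trans xx' hx).
have E3 : Triple V2 c3 U3 = Triple V2 c2 U2.
  exact: xexp_uniqm h1 (xexp_trans yy hy) _.
have E4 : Triple V2 c4 U4 = Triple V2 c2 U2.
  exact: xexp_uniqm h3 (xexp_trans yy' hy) _.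
have [_ E _] : [/\ V2 = V2, c3 = c4 & U3 = U4].
  by apply: triple_inj; rewrite E3 E4.
have [_ _ E'] : [/\ V2 = V2, c3 = c4 & U3 = U4].
  by apply: triple_inj; rewrite E3 E4.
by rewrite (xexp_pi h2) (xexp_pi h4) E E'.
Qed.

Definition bV_mul (x y : bV) : bV := sval (cid (bV_prod_ex x y)).
Definition bV_inv (x : bV) : bV := \pi_bV (triple_inv (repr x)).
Definition leaf1 : treeN 1%N := Sub Leaf (eqxx 1%N).
Definition bV_one : bV := \pi_bV (Triple leaf1 1 leaf1).

Lemma bV_mulE n (T V U : treeN n) b c :
  bV_mul (\pi_bV (Triple T b V)) (\pi_bV (Triple V c U)) =
  \pi_bV (Triple T (b * c) U).
Proof. by rewrite /bV_mul; case: cid => z /= p; apply: bV_prod_uniq p _. Qed.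

Lemma pi_triple_inv x y : \pi_bV x = \pi_bV y ->
  \pi_bV (triple_inv x) = \pi_bV (triple_inv y).
Proof.
by case/pi_xexp=> z /xexp_inv/xexp_pi-> /xexp_inv/xexp_pi->.
Qed.

Lemma bV_invE n (T V : treeN n) b :
  bV_inv (\pi_bV (Triple T b V)) = \pi_bV (Triple V b^-1 T).
Proof.
rewrite -[RHS]/(\pi_bV (triple_inv (Triple T b V))).
by apply: pi_triple_inv; rewrite reprK.
Qed.

Lemma bV_oneE n (T : treeN n) : bV_one = \pi_bV (Triple T 1 T).
Proof.
pose x0 := Triple leaf1 1 leaf1.
have [y xy yE] : exists2 y, xexp x0 y & rtp y = val T by exact: xexp_ex.
have : tbraid y = 1 /\ tminus y = tplus y.
  have : tbraid x0 = 1 /\ tminus x0 = tplus x0 by [].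
  elim: xy {yE} => // x _ z [k ->] _ IH [b1 TV]; apply: IH => /=.
  by rewrite b1 cable1 rho1 perm1 TV.
have [T' [b E]] := triple_matchp yE; rewrite /bV_one (xexp_pi xy) E /=.
by case=> -> ->.
Qed.

Lemma bV_mulA : associative bV_mul.
Proof.
move=> x y z; elim/bVW: x => n0 T0 V0 b0; rewrite -[y]reprK -[z]reprK.
have [n [T [V [U [b [c [/xexp_pi-> /xexp_pi->]]]]]]] := composable (repr y) (repr z).
have [m [T1 [V1 [U1 [b1 [c1 [h0 h1]]]]]]] :=
  composable (Triple T0 b0 V0) (Triple T b V).
have [U2 [c2 [h2 h3]]] := @xexp_mul _ T V U b c _ _ _ _ h1.
by rewrite bV_mulE (xexp_pi h0) (xexp_pi h1) (xexp_pi h2) (xexp_pi h3) !bV_mulE mulgA.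
Qed.

Lemma bV_mul1 : left_id bV_one bV_mul.
Proof. by elim/bVW=> n T V b; rewrite (bV_oneE T) bV_mulE mul1g. Qed.

Lemma bV_1mul : right_id bV_one bV_mul.
Proof. by elim/bVW=> n T V b; rewrite (bV_oneE V) bV_mulE mulg1. Qed.

Lemma bV_Vmul : left_inverse bV_one bV_inv bV_mul.
Proof. by elim/bVW=> n T V b; rewrite bV_invE bV_mulE mulVg -bV_oneE. Qed.

Lemma bV_mulV : right_inverse bV_one bV_inv bV_mul.
Proof. by elim/bVW=> n T V b; rewrite bV_invE bV_mulE mulgV -bV_oneE. Qed.

HB.instance Definition _ :=
  isGroup.Build bV bV_mulA bV_mul1 bV_1mul bV_Vmul bV_mulV.

(* The letter of index i crosses two of the first n.-1 strands when
   i.+2 < n; these letters generate the standard copy of B_(n-1) in B_n. *)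
Definition hat_word n (w : bword n) : bool :=
  all (fun l : letter n => l.1.+2 < n) w.
Definition hat_braid n (b : braid n) : Prop :=
  exists2 w, hat_word w & b = \pi_(braid n) w.

Lemma hat_braidM n (b c : braid n) : hat_braid b -> hat_braid c -> hat_braid (b * c).
Proof.
move=> [u hu ->] [v hv ->]; exists (u ++ v); last by rewrite pi_catM.
by rewrite /hat_word all_cat; apply/andP.
Qed.

Lemma hat_braidV n (b : braid n) : hat_braid b -> hat_braid b^-1.
Proof.
move=> [w hw ->]; exists (word_inv w); last by rewrite pi_inv.
by rewrite /hat_word /word_inv all_map all_rev.
Qed.

Lemma hat_braid1 n : hat_braid (1 : braid n).
Proof. by exists [::]. Qed.

Lemma hat_cable n (b : braid n) k : hat_braid b -> hat_braid (cable b k).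
Proof.
case=> w hw ->; exists (cable_word k w); last by rewrite cable_pi.
elim: w hw => //= -[i e] w IHw /andP[/= ii /IHw ww].
rewrite /hat_word all_cat -/(hat_word (cable_word k w)) ww andbT /cable_letter.
by do !case: ifP => _; rewrite /= ?andbT; lia.
Qed.

Definition hat_bV : {pred bV} := fun x =>
  `[< exists n (T V : treeN n) b, hat_braid b /\ x = \pi_bV (Triple T b V) >].

Lemma hat_bVP n (T V : treeN n) b : hat_braid b -> \pi_bV (Triple T b V) \in hat_bV.
Proof. by move=> hb; apply/asboolP; exists n, T, V, b. Qed.

Lemma xexp_hat x y : xexp x y -> hat_braid (tbraid x) -> hat_braid (tbraid y).
Proof. by elim=> // {}x z {}y [k ->] _ IH hx; apply: IH; exact: hat_cable. Qed.

Lemma hat_bV_group_closed : group_closed hat_bV.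
Proof.
split; first by apply: hat_bVP; exact: hat_braid1.
move=> x y /asboolP[n [T [V [b [hb ->]]]]] /asboolP[m [T' [V' [b' [hb' ->]]]]].
rewrite [(_)^-1]bV_invE.
have [k [T1 [V1 [U1 [b1 [c1 [h1 h2]]]]]]] := composable (Triple T b V) (Triple V' b'^-1 T').
rewrite (xexp_pi h1) (xexp_pi h2) [_ * _]bV_mulE; apply: hat_bVP.
apply: hat_braidM; first exact: xexp_hat h1 hb.
by apply: xexp_hat h2 _; exact: hat_braidV.
Qed.

Definition hatbV := {x : bV | x \in hat_bV}.
HB.instance Definition _ := SubChoice.on hatbV.
HB.instance Definition _ :=
  SubChoice_isSubGroup.Build bV hat_bV hatbV hat_bV_group_closed.

Import Order.TTheory GRing.Theory Num.Theory.

Section BoundedCohomology.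
Local Open Scope ring_scope.
Variables (R : realType) (G : groupType).

Definition cochain n := n.-tuple G -> R.
HB.instance Definition _ n := GRing.Zmodule.on (cochain n).

(* (g_1, ..., g_i g_(i+1), ..., g_(n+1)), with i counted from 0. *)
Definition mul_adjacent n (g : n.+1.-tuple G) (i : 'I_n) : n.-tuple G :=
  [tuple if (j < i)%N then tnth g (widen_ord (leqnSn n) j)
         else if j == i
              then (tnth g (widen_ord (leqnSn n) j) * tnth g (lift ord0 j))%g
              else tnth g (lift ord0 j) | j < n].

(* In degree n = 0 the two outer terms cancel and the coboundary is zero. *)
Definition coboundary n (f : cochain n) : cochain n.+1 := fun g =>
  f [tuple tnth g (lift ord0 j) | j < n]
  + \sum_(i < n) (-1) ^+ i.+1 * f (mul_adjacent g i)
  + (-1) ^+ n.+1 * f [tuple tnth g (widen_ord (leqnSn n) j) | j < n].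

Lemma coboundaryB n : {morph @coboundary n : f h / f - h}.
Proof.
move=> f h; apply/funext => g.
have fctB m (u v : cochain m) x : (u - v) x = u x - v x by [].
rewrite fctB /coboundary !fctB.
under eq_bigr do rewrite fctB mulrBr.
by rewrite sumrB; ring.
Qed.

Lemma coboundary0 n : coboundary (0 : cochain n) = 0.
Proof. by rewrite -[X in coboundary X](subrr 0) coboundaryB subrr. Qed.

Definition bounded_cochain n (f : cochain n) : Prop :=
  exists M, forall g, `|f g| <= M.

Lemma bounded_cochain0 n : bounded_cochain (0 : cochain n).
Proof. by exists 0 => g; rewrite normr0. Qed.

Lemma bounded_cochainB n (f h : cochain n) :
  bounded_cochain f -> bounded_cochain h -> bounded_cochain (f - h).
Proof.
move=> [M fM] [N hN]; exists (M + N) => g.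
by rewrite (le_trans (ler_normB _ _)) ?lerD.
Qed.

Definition bcocycles n : {pred cochain n} :=
  fun f => `[< bounded_cochain f /\ coboundary f = 0 >].

Fact bcocycles_zmod_closed n : zmod_closed (@bcocycles n).
Proof.
split=> [|f h /asboolP[bf df] /asboolP[bh dh]]; apply/asboolP; split.
- exact: bounded_cochain0.
- exact: coboundary0.
- exact: bounded_cochainB.
- by rewrite coboundaryB df dh subrr.
Qed.
HB.instance Definition _ n :=
  GRing.isZmodClosed.Build (cochain n) (@bcocycles n) (@bcocycles_zmod_closed n).

Definition bcocycle n := {f : cochain n | f \in @bcocycles n}.
HB.instance Definition _ n := SubChoice.on (bcocycle n).
HB.instance Definition _ n := [SubChoice_isSubZmodule of bcocycle n by <:].

Definition bcoboundaries n : {pred bcocycle n} :=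
  match n with
  | 0 => fun c => c == 0
  | m.+1 => fun c => `[< exists2 f : cochain m,
                         bounded_cochain f & val c = coboundary f >]
  end.

Fact bcoboundaries_zmod_closed n : zmod_closed (@bcoboundaries n).
Proof.
case: n => [|n]; split=> [|c d].
- exact/eqP.
- by move=> /eqP-> /eqP->; rewrite subrr; apply/eqP.
- by apply/asboolP; exists 0; [exact: bounded_cochain0|rewrite coboundary0].
move=> /asboolP[f bf cf] /asboolP[h bh dh]; apply/asboolP.
by exists (f - h); [exact: bounded_cochainB|rewrite coboundaryB -cf -dh].
Qed.
HB.instance Definition _ n :=
  GRing.isZmodClosed.Build (bcocycle n) (@bcoboundaries n)
    (@bcoboundaries_zmod_closed n).

(* H^n_b(G): bounded cocycles modulo coboundaries of bounded cochains; only its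
   additive group structure is provided. *)
Definition Hb n := Quotient.quot (@bcoboundaries n : zmodClosed _).
HB.instance Definition _ n := GRing.Zmodule.on (Hb n).

Lemma Hb_eq0P n : (forall c : Hb n.+1, c = 0) <->
  forall f : cochain n.+1, bounded_cochain f -> coboundary f = 0 ->
  exists2 h : cochain n, bounded_cochain h & f = coboundary h.
Proof.
split=> [H f bf df|H c].
  have fP : f \in @bcocycles n.+1 by apply/asboolP.
  pose c : bcocycle n.+1 := Sub f fP.
  have : (c == 0 %[mod Hb n.+1])%qT by apply/eqP; rewrite [LHS]H [RHS]H.
  by rewrite -Quotient.idealrBE subr0 => /asboolP.
rewrite -[c]reprK -[RHS]reprK.
apply/eqP; rewrite -Quotient.idealrBE; apply/asboolP.
set d := _ - _; have /asboolP[bd dd] := valP d.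
exact: H.
Qed.

End BoundedCohomology.

(* Main.v *)
Require Import Defs.
From mathcomp Require Import all_boot order ssralg ssrnum archimedean reals.
From HB Require Import structures.
From mathcomp Require Import boolp classical_sets.
From mathcomp Require Import ring lra zify.

(** The group of the theorem has a subgroup [B], a copy of the braided Thompson
    group supported on the left half of the trees, that can be moved away from
    itself while staying inside itself.  Write [T, b, U] for the class of a
    triple and [x ^ p] for [p^-1 x p].  The elements of [B] are the classes
    [Caret T Leaf, b, Caret U Leaf] in which [b] leaves the last strand alone.
    Conjugation by the element [squeeze], of Thompson's group F, sends such a
    class to [Caret (Caret T Leaf) Leaf, b, Caret (Caret U Leaf) Leaf], and
    conjugation by [swap], the same tree pair with one crossing, sends it to
    [Caret (Caret Leaf T) Leaf, 1 + b, Caret (Caret Leaf U) Leaf], where [1 + b]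
    is [b] moved one strand to the right: pulling [b] through a strand does not
    change it ([nbraid_crossing]).  Two such images commute, since after
    expansion their braids involve disjoint blocks of strands
    ([squeeze_swap_commute]).  Moreover every element [x] of the whole group can
    be written [squeeze ^+ i * y * squeeze ^- j] with [y] in [B], because
    multiplication by [squeeze] rotates a tree, which changes the length of its
    rightmost branch by one ([hat_exhaust]).  These properties are collected in the record [displacing].

    They imply the vanishing of the second bounded cohomology, for any group [G]
    ([displacing_Hb2_eq0]).  A bounded 2-cocycle [w] defines a central extension
    [E] of [G] by the reals, on which the real coordinate is a quasimorphism.
    Let [psi] be its homogenization.  If [psi] is a morphism, then
    [g |-> psi (g, 0)] is a bounded function with coboundary [w].  To see that
    it is one:
    - elements of [E] commute as soon as their images in [G] do, because the
      commutator of lifts is additive under powers of its first argument and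
      bounded ([ext_commute]); so [E] inherits the structure [displacing];
    - conjugating by [q p^i], for all [i], gives infinitely many pairwise
      commuting copies of the preimage of [B].  Multiplying [N] copies of [x]
      and of [y] multiplies the additivity error of [psi] at [(x, y)] by [N],
      while this error stays bounded; so [psi] is additive on the preimage of
      [B] ([hqm_additive_displaced]);
    - the powers of [p] act on the increasing union of the conjugates of [B] by
      these powers, and the quotient by this union is cyclic, which
      extends additivity to all of [E] ([hqm_displacing_morphism]). *)

Set Implicit Arguments.
Unset Strict Implicit.
Unset Printing Implicit Defensive.

Import Order.TTheory GRing.Theory Num.Theory.
Local Open Scope group_scope.
Local Open Scope quotient_scope.

(** * Quasimorphisms and their homogenization *)

Lemma bounded_multiples0 (R : realType) (r C : R) :
  (forall n, `|n.+1%:R * r| <= C)%R -> r = 0%R.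
Proof.
move=> rC; apply/eqP; rewrite -normr_le0 leNgt; apply/negP => r0.
have C0 : (0 <= C)%R by apply: le_trans (rC 0); exact: normr_ge0.
have := truncnS_gt (C / `|r|)%R; rewrite ltr_pdivrMr // ltNge => /negP; apply.
by rewrite -[X in (X * _)%R]ger0_norm ?ler0n// -normrM.
Qed.

Definition quasimorphism (R : realType) (E : groupType) (D : R) (phi : E -> R) :=
  forall x y, (`|phi (x * y)%g - phi x - phi y| <= D)%R.

(** The limit of [phi (x ^+ n) / n], obtained as a supremum: for a quasimorphism
    of defect [D], every [(phi (x ^+ n) - D) / n] is at most every
    [(phi (x ^+ m) + D) / m], and the limit is the unique real in between. *)
Definition homogenization (R : realType) (E : groupType) (D : R) (phi : E -> R)
    (x : E) : R :=
  sup [set ((phi (x ^+ n.+1)%g - D) / n.+1%:R)%R | n in [set: nat]].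

Section Homogenization.
Variables (R : realType) (E : groupType) (D : R) (phi : E -> R).
Hypothesis phiQ : quasimorphism D phi.

Lemma quasimorphismX x n : (`|phi (x ^+ n.+1)%g - n.+1%:R * phi x| <= n%:R * D)%R.
Proof.
elim: n => [|n IHn]; first by rewrite expg1 mul1r subrr normr0 mul0r.
rewrite expgS; have := phiQ x (x ^+ n.+1).
move: IHn; rewrite !ler_norml -(natr1 n.+1) -(natr1 n).
by move: (phi x) (phi _) (phi (x * _)) => a b c; lra.
Qed.

Lemma quasimorphism_ge0 : (0 <= D)%R.
Proof. exact: le_trans (phiQ 1 1). Qed.

(** Both sides compare [phi] at the common power [x ^+ (m.+1 * n.+1)]. *)
Lemma homogenization_interval x m n :
  ((phi (x ^+ n.+1)%g - D) / n.+1%:R <= (phi (x ^+ m.+1)%g + D) / m.+1%:R)%R.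
Proof.
rewrite ler_pdivrMr ?ltr0Sn// mulrAC ler_pdivlMr ?ltr0Sn//.
have := quasimorphismX (x ^+ m.+1) n; have := quasimorphismX (x ^+ n.+1) m.
rewrite -!expgnA mulnC !ler_norml -!natr1; have := quasimorphism_ge0.
by move: (phi _) (phi (x ^+ n.+1)%g) (phi (x ^+ m.+1)%g) => a b c; lra.
Qed.

Lemma homogenizationP x n :
  (`|phi (x ^+ n)%g - n%:R * homogenization D phi x| <= D)%R.
Proof.
case: n => [|n].
  have := phiQ 1 1; rewrite mulg1 expg0 mul0r subr0 => h.
  by rewrite -normrN (_ : (- phi 1 = phi 1 - phi 1 - phi 1)%R) //; ring.
set S := [set ((phi (x ^+ k.+1)%g - D) / k.+1%:R)%R | k in [set: nat]]%classic.
have ubS k : ubound S ((phi (x ^+ k.+1)%g + D) / k.+1%:R)%R.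
  by move=> _ [m _ <-]; exact: homogenization_interval.
have h1 : ((phi (x ^+ n.+1)%g - D) / n.+1%:R <= homogenization D phi x)%R.
  by apply: ub_le_sup; [exists ((phi (x ^+ 1)%g + D) / 1%:R)%R; exact: ubS|exists n].
have h2 : (homogenization D phi x <= (phi (x ^+ n.+1)%g + D) / n.+1%:R)%R.
  by apply: ge_sup (ubS n); exists ((phi (x ^+ 1)%g - D) / 1%:R)%R; exists 0.
move: h1 h2; rewrite ler_pdivrMr ?ltr0Sn// ler_pdivlMr ?ltr0Sn// ler_norml; lra.
Qed.

(** Two rates of linear growth at bounded distance agree.  Homogeneity, conjugation
    invariance and additivity on commuting elements are read off from this. *)
Lemma homogenization_uniq x r C :
  (forall n, `|phi (x ^+ n)%g - n%:R * r| <= C)%R -> homogenization D phi x = r.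
Proof.
move=> h; apply/eqP; rewrite -subr_eq0; apply/eqP.
apply: (@bounded_multiples0 _ _ (D + C)%R) => n.
have := homogenizationP x n.+1; have := h n.+1; rewrite !ler_norml; lra.
Qed.
End Homogenization.

Record homogeneous_quasimorphism (R : realType) (E : groupType) (psi : E -> R) :
    Prop := HomogeneousQuasimorphism {
  hqm_defect : exists C, quasimorphism C psi;
  hqmX : forall x n, psi (x ^+ n)%g = (n%:R * psi x)%R;
  hqmJ : forall x y, psi (x ^ y) = psi x;
  hqm_commute : forall x y, commute x y -> psi (x * y)%g = (psi x + psi y)%R }.

Lemma homogenization_hqm (R : realType) (E : groupType) (D : R) (phi : E -> R) :
  quasimorphism D phi -> homogeneous_quasimorphism (homogenization D phi).
Proof.
move=> phiQ; have hP := homogenizationP phiQ.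
split.
- exists (D + D + D + D)%R => x y.
  have := phiQ x y; have := hP x 1%N; have := hP y 1%N; have := hP (x * y)%g 1%N.
  by rewrite !expg1 !mul1r !ler_norml; lra.
- move=> x n; apply: (homogenization_uniq phiQ (C := D)) => k.
  by rewrite -expgnA mulrA -natrM mulnC; exact: hP.
- move=> x y; apply: (homogenization_uniq phiQ
    (C := D + D + D + `|phi y| + `|phi y^-1%g|)%R) => n.
  rewrite -conjXg conjgE; have := phiQ y^-1 (x ^+ n * y).
  have := phiQ (x ^+ n) y; have := hP x n; rewrite !ler_norml.
  have := ler_norm (phi y); have := ler_norm (phi y^-1%g).
  have := ler_norm (- phi y)%R; have := ler_norm (- phi y^-1%g)%R; rewrite !normrN.
  lra.
- move=> x y xy; apply: (homogenization_uniq phiQ (C := D + D + D)%R) => n.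
  rewrite expgMn //; have := phiQ (x ^+ n) (y ^+ n).
  have := hP x n; have := hP y n; rewrite !ler_norml; lra.
Qed.

(** Think of [B] as the elements supported on a region: [p] and [q] move this
    region onto disjoint parts of itself, and every element of [G] is supported on
    the region up to powers of [p].  Iterating [p] after [q] yields infinitely
    many disjoint copies of the region. *)
Record displacing (G : groupType) (B : G -> Prop) (p q : G) : Prop := Displacing {
  disM : forall x y, B x -> B y -> B (x * y);
  disV : forall x, B x -> B x^-1;
  disJp : forall x, B x -> B (x ^ p);
  disJq : forall x, B x -> B (x ^ q);
  disC : forall x y, B x -> B y -> commute (x ^ p) (y ^ q);
  dis_exhaust : forall x, exists a b y, B y /\ x = p ^+ a * y * p ^- b }.

(** * Homogeneous quasimorphisms on groups with a displacing pair *)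

Section DisplacedHomogeneous.
Variables (R : realType) (E : groupType) (B : E -> Prop) (p q : E).
Hypothesis dis : displacing B p q.
Variable psi : E -> R.
Hypothesis psiH : homogeneous_quasimorphism psi.

Lemma displacing_JpX x i : B x -> B (x ^ (p ^+ i)).
Proof.
move=> Bx; elim: i => [|i IHi]; first by rewrite expg0 conjg1.
by rewrite expgSr conjgM; exact: (disJp dis).
Qed.

Lemma displacing_copy x i : B x -> B (x ^ (q * p ^+ i)).
Proof. by move=> Bx; rewrite conjgM; exact/displacing_JpX/(disJq dis). Qed.

(** With [i < j], both elements are conjugates by [p ^+ i] of, respectively, an
    element of [B ^ q] and an element of [B ^ p]. *)
Lemma commute_copies x y i j : B x -> B y -> i < j ->
  commute (x ^ (q * p ^+ i)) (y ^ (q * p ^+ j)).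
Proof.
move=> Bx By ij; have -> : j = ((j - i.+1).+1 + i)%N by lia.
rewrite expgnDr mulgA !(conjgM _ _ (p ^+ i)) expgSr mulgA (conjgM y).
rewrite /commute -!conjMg; congr (_ ^ _).
exact: commute_sym (disC dis (displacing_copy _ By) Bx).
Qed.

Lemma commute_prod_copies x y N j : B x -> B y -> N <= j ->
  commute (\prod_(i < N) x ^ (q * p ^+ i)) (y ^ (q * p ^+ j)).
Proof.
move=> Bx By Nj; apply: commute_sym; apply: commute_prod => i _.
by apply: commute_sym; apply: commute_copies => //; apply: leq_trans Nj.
Qed.

Lemma hqm_prod_copies x N : B x ->
  psi (\prod_(i < N) x ^ (q * p ^+ i)) = (N%:R * psi x)%R.
Proof.
move=> Bx; elim: N => [|N IHN].
  by rewrite big_ord0 -(expg0 1) (hqmX psiH) !mul0r.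
rewrite big_ord_recr /= (hqm_commute psiH); last exact: commute_prod_copies.
by rewrite IHN (hqmJ psiH) -natr1; ring.
Qed.

Lemma prod_copiesM x y N : B x -> B y ->
  \prod_(i < N) (x * y) ^ (q * p ^+ i) =
  (\prod_(i < N) x ^ (q * p ^+ i)) * (\prod_(i < N) y ^ (q * p ^+ i)).
Proof.
move=> Bx By; elim: N => [|N IHN]; first by rewrite !big_ord0 mulg1.
rewrite !big_ord_recr /= IHN conjMg.
have C := commute_prod_copies By Bx (leqnn N).
move: (\prod_(i < N) x ^ _) (\prod_(i < N) y ^ _) (x ^ _) (y ^ _) C => P Q X Y C.
by rewrite -!mulgA; congr (_ * _); rewrite !mulgA C.
Qed.

(** On the product of [n] commuting copies, the additivity error of [psi] is [n]
    times the error at [(x, y)], whereas the defect bounds it uniformly. *)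
Lemma hqm_additive_displaced x y : B x -> B y -> psi (x * y)%g = (psi x + psi y)%R.
Proof.
move=> Bx By; apply/eqP; rewrite -subr_eq0 opprD addrA; apply/eqP.
have [C psiC] := hqm_defect psiH.
apply: (@bounded_multiples0 _ _ C) => n.
have := psiC (\prod_(i < n.+1) x ^ (q * p ^+ i)) (\prod_(i < n.+1) y ^ (q * p ^+ i)).
by rewrite -prod_copiesM // !hqm_prod_copies // -?mulrBr //; exact: (disM dis).
Qed.

Lemma hqmV x : psi x^-1 = (- psi x)%R.
Proof.
apply/eqP; rewrite -subr_eq0 opprK -(hqm_commute psiH).
  by rewrite mulVg -(expg0 1) (hqmX psiH) mul0r.
exact/commute_sym/commuteV.
Qed.

(** The power [(p ^+ m * x) ^+ N] is [p ^+ (m * N)] times a product of [N] elements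
    of [B], each conjugate to [x]; dividing by [N] removes the defect. *)
Lemma hqm_pX m x : B x -> psi (p ^+ m * x) = (m%:R * psi p + psi x)%R.
Proof.
move=> Bx; apply/eqP; rewrite -subr_eq0; apply/eqP.
have [C psiC] := hqm_defect psiH.
have powE N : exists2 X, B X /\ psi X = (N.+1%:R * psi x)%R
    & (p ^+ m * x) ^+ N.+1 = p ^+ (m * N.+1) * X.
  elim: N => [|N [X [BX psiX] XE]]; first by exists x; rewrite ?muln1 ?mul1r.
  exists (x ^ (p ^+ (m * N.+1)) * X).
    have Bx' := displacing_JpX (m * N.+1) Bx.
    split; first exact: (disM dis).
    by rewrite hqm_additive_displaced // (hqmJ psiH) psiX -[in RHS]natr1; ring.
  rewrite expgS XE (mulnS m N.+1) expgnDr; move: (p ^+ (m * N.+1)) => P.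
  by rewrite conjgE !mulgA mulgK.
apply: (@bounded_multiples0 _ _ C) => N.
have [X [BX psiX] XE] := powE N.
have := psiC (p ^+ (m * N.+1)) X; rewrite -XE !(hqmX psiH) psiX natrM.
by congr (`| _ | <= _)%R; ring.
Qed.

(** After a conjugation by a power of [p], only one of the outer powers remains;
    passing to inverses, it may be taken to be the one on the left. *)
Lemma hqm_pXM a b x : B x ->
  psi (p ^+ a * x * p ^- b) = (psi x + a%:R * psi p - b%:R * psi p)%R.
Proof.
wlog ab : a b x / b <= a => [th Bx|Bx].
  have [/th->//|ab] := leqP b a.
  rewrite -[_ * _]invgK hqmV !invgM invgK mulgA th ?hqmV; [|lia|exact: (disV dis)].
  ring.
rewrite -(hqmJ psiH _ (p ^+ b)) conjgE mulgVK mulgA.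
have -> : p ^- b * p ^+ a = p ^+ (a - b).
  by rewrite -{1}(subnKC ab) expgnDr mulKg.
by rewrite hqm_pX // natrB //; ring.
Qed.

(** As [B ^ p] lies in [B], the inner powers of [p] in the expressions of [x] and
    [y] can be raised until they cancel in the product. *)
Lemma hqm_displacing_morphism x y : psi (x * y)%g = (psi x + psi y)%R.
Proof.
have raise k a b z : B z ->
    exists2 z', B z' & p ^+ a * z * p ^- b = p ^+ (a + k) * z' * p ^- (b + k).
  move=> Bz; exists (z ^ (p ^+ k)); first exact: displacing_JpX.
  by rewrite conjgE !(expgnDr p) invgM !mulgA mulgK mulgK.
have [a [b [x' [Bx ->]]]] := dis_exhaust dis x.
have [c [d [y' [By ->]]]] := dis_exhaust dis y.
have [x2 Bx2 ->] := raise c a b _ Bx; have [y2 By2 ->] := raise b c d _ By.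
have -> : p ^+ (a + c) * x2 * p ^- (b + c) * (p ^+ (c + b) * y2 * p ^- (d + b)) =
          p ^+ (a + c) * (x2 * y2) * p ^- (d + b).
  by rewrite (addnC b c) !mulgA mulgVK.
rewrite !hqm_pXM //; last exact: (disM dis).
by rewrite hqm_additive_displaced // !natrD; ring.
Qed.
End DisplacedHomogeneous.

(** * The central extension defined by a bounded cocycle *)

Definition cocycle2 (R : realType) (G : groupType) (w : G -> G -> R) := forall g h k,
  (w h k + w g (h * k)%g = w (g * h)%g k + w g h)%R.

Definition extension (R : realType) (G : groupType) (w : G -> G -> R)
  of cocycle2 w : Type := (G * R)%type.

Section CentralExtension.
Variables (R : realType) (G : groupType) (w : G -> G -> R) (wC : cocycle2 w).
Local Notation E := (extension wC).

HB.instance Definition _ := Choice.copy E (G * R)%type.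

Definition ext_mul (x y : E) : E := (x.1 * y.1, (x.2 + y.2 + w x.1 y.1)%R).
(* The cocycle is not normalized: [w 1 1] may be nonzero. *)
Definition ext_one : E := (1, (- w 1 1)%R).
Definition ext_inv (x : E) : E := (x.1^-1, (- x.2 - w x.1^-1 x.1 - w 1 1)%R).

Lemma cocycle2_1g g : w 1 g = w 1 1.
Proof. by have := wC 1 1 g; rewrite !mul1g; lra. Qed.

Lemma cocycle2_g1 g : w g 1 = w 1 1.
Proof. by have := wC g 1 1; rewrite !mulg1; lra. Qed.

Lemma cocycle2_V g : w g g^-1 = w g^-1 g.
Proof.
by have := wC g g^-1 g; rewrite mulgV mulVg cocycle2_1g cocycle2_g1; lra.
Qed.

Fact ext_mulA : associative ext_mul.
Proof.
move=> [g r] [h s] [k t]; rewrite /ext_mul /= mulgA; congr pair.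
by have := wC g h k; lra.
Qed.

Fact ext_mul1 : left_id ext_one ext_mul.
Proof. by move=> [g r]; rewrite /ext_mul /= mul1g cocycle2_1g; congr pair; lra. Qed.

Fact ext_1mul : right_id ext_one ext_mul.
Proof. by move=> [g r]; rewrite /ext_mul /= mulg1 cocycle2_g1; congr pair; lra. Qed.

Fact ext_Vmul : left_inverse ext_one ext_inv ext_mul.
Proof. by move=> [g r]; rewrite /ext_mul /= mulVg; congr pair; lra. Qed.

Fact ext_mulV : right_inverse ext_one ext_inv ext_mul.
Proof.
by move=> [g r]; rewrite /ext_mul /= mulgV cocycle2_V; congr pair; lra.
Qed.

HB.instance Definition _ :=
  isGroup.Build E ext_mulA ext_mul1 ext_1mul ext_Vmul ext_mulV.

Definition ext_proj (x : E) : G := x.1.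

Fact ext_proj_morph : {morph ext_proj : x y / x * y}.
Proof. by []. Qed.
Fact ext_proj1 : ext_proj 1 = 1. Proof. by []. Qed.
HB.instance Definition _ := isUMagmaMorphism.Build E G ext_proj
  (conj ext_proj1 ext_proj_morph).

Definition ext_height (x : E) : R := x.2.
(** Multiplication by a central real, defined directly so as to keep the
    unnormalized value [w 1 1] out of the computations. *)
Definition ext_shift (c : R) (x : E) : E := (x.1, (x.2 + c)%R).

Lemma ext_shiftMl c x y : ext_shift c x * y = ext_shift c (x * y).
Proof. by congr pair => /=; lra. Qed.

Lemma ext_shiftMr c x y : x * ext_shift c y = ext_shift c (x * y).
Proof. by congr pair => /=; lra. Qed.

Lemma ext_shiftD c d x : ext_shift c (ext_shift d x) = ext_shift (c + d)%R x.
Proof. by congr pair => /=; lra. Qed.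

Lemma ext_shift0 x : ext_shift 0%R x = x.
Proof. by case: x => g r; congr pair; rewrite /= addr0. Qed.

Lemma ext_shiftX c x n : (ext_shift c x) ^+ n = ext_shift (n%:R * c)%R (x ^+ n).
Proof.
elim: n => [|n IHn]; first by rewrite mul0r ext_shift0.
rewrite !expgS IHn ext_shiftMl ext_shiftMr ext_shiftD -natr1.
by congr (ext_shift _ _); ring.
Qed.

Variable D : R.
Hypothesis wD : forall g h, (`|w g h| <= D)%R.

Lemma ext_height_quasimorphism : quasimorphism D ext_height.
Proof.
move=> x y; rewrite [X in `|X|%R](_ : _ = w (ext_proj x) (ext_proj y)) //.
by rewrite /ext_height /ext_proj /=; lra.
Qed.

(** For commuting images, [x * y] and [y * x] differ by a central real [c].  Then
    [x ^+ n * y] and [y * x ^+ n] differ by [n * c]; this is a difference of two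
    values of the bounded cocycle, so [c = 0]. *)
Lemma ext_commute x y : commute (ext_proj x) (ext_proj y) -> commute x y.
Proof.
move=> xy; pose c := (ext_height (x * y)%g - ext_height (y * x)%g)%R.
have xyE : x * y = ext_shift c (y * x).
  by congr pair; rewrite // /c /ext_height /=; lra.
have xnyE n : x ^+ n * y = ext_shift (n%:R * c)%R (y * x ^+ n).
  elim: n => [|n IHn]; first by rewrite mul0r ext_shift0 mul1g mulg1.
  rewrite expgS -mulgA IHn ext_shiftMr mulgA xyE ext_shiftMl ext_shiftD -mulgA.
  by rewrite -natr1; congr (ext_shift _ _); ring.
rewrite /commute xyE (_ : c = 0%R) ?ext_shift0 //.
apply: (@bounded_multiples0 _ _ (D + D)%R) => n.
have := ext_height_quasimorphism (x ^+ n.+1) y.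
have := ext_height_quasimorphism y (x ^+ n.+1).
have -> : ext_height (x ^+ n.+1 * y)%g =
    (ext_height (y * x ^+ n.+1)%g + n.+1%:R * c)%R by rewrite xnyE.
rewrite !ler_norml; move: (ext_height _) (ext_height y) (ext_height (x ^+ n.+1)%g) (_ * c)%R.
by move=> a b d e; lra.
Qed.

Lemma homogenization_ext_shift c x :
  (homogenization D ext_height (ext_shift c x) =
   homogenization D ext_height x + c)%R.
Proof.
apply: (homogenization_uniq ext_height_quasimorphism (C := D)) => n.
have := homogenizationP ext_height_quasimorphism x n; rewrite ext_shiftX.
rewrite (_ : ext_height (ext_shift _ _) = ext_height (x ^+ n)%g + n%:R * c)%R //.
by congr (`| _ | <= _)%R; ring.
Qed.

(** On the set-theoretic section [g |-> (g, 0)] the homogenization is bounded, as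
    the real coordinate vanishes there, and multiplicativity of the section fails
    exactly by [w]. *)
Lemma bounded_primitive_of_morphism :
  (forall x y : E, homogenization D ext_height (x * y)%g =
     homogenization D ext_height x + homogenization D ext_height y)%R ->
  exists2 h : G -> R, (forall g, `|h g| <= D)%R
    & forall g k, w g k = (h k - h (g * k)%g + h g)%R.
Proof.
move=> psiM; pose s g : E := (g, 0%R).
exists (fun g => homogenization D ext_height (s g))%R => [g|g k].
  have := homogenizationP ext_height_quasimorphism (s g) 1%N.
  by rewrite expg1 mul1r /ext_height /= sub0r normrN.
have E : s g * s k = ext_shift (w g k) (s (g * k)) by congr pair; rewrite /=; lra.
by have := psiM (s g) (s k); rewrite E homogenization_ext_shift; lra.
Qed.

Lemma displacing_ext (B : G -> Prop) p q : displacing B p q ->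
  @displacing E (fun x => B (ext_proj x)) (p, 0%R) (q, 0%R).
Proof.
move=> dis; split.
- by move=> x y Bx By; rewrite gmulfM; exact: (disM dis).
- by move=> x Bx; rewrite gmulfV; exact: (disV dis).
- by move=> x Bx; rewrite gmulfJ; exact: (disJp dis).
- by move=> x Bx; rewrite gmulfJ; exact: (disJq dis).
- by move=> x y Bx By; apply: ext_commute; rewrite !gmulfJ; exact: (disC dis).
move=> x; have [a [b [y [By xE]]]] := dis_exhaust dis (ext_proj x).
pose p' : E := (p, 0%R).
exists a, b, (p' ^- a * x * p' ^+ b); split; last first.
  by rewrite !mulgA mulgV mul1g mulgK.
rewrite !gmulfM gmulfV !gmulfXn /= xE !mulgA.
by rewrite mulVg mul1g mulgVK.
Qed.
End CentralExtension.

Theorem displacing_Hb2_eq0 (R : realType) (G : groupType) (B : G -> Prop) (p q : G) :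
  displacing B p q -> forall c : Hb R G 2, c = 0%R.
Proof.
move=> dis; apply/Hb_eq0P => f [D fD] df.
pose w g h : R := f [tuple g; h].
have wC : cocycle2 w.
  move=> g h k; have := congr1 (fun F => F [tuple g; h; k]) df.
  rewrite /coboundary !big_ord_recl big_ord0 /=.
  have -> : [tuple tnth [tuple g; h; k] (lift ord0 j) | j < 2] = [tuple h; k].
    by apply: eq_from_tnth => i; rewrite tnth_mktuple; case: i => [[|[|i]] hi].
  have -> : [tuple tnth [tuple g; h; k] (widen_ord (leqnSn 2) j) | j < 2] =
      [tuple g; h].
    by apply: eq_from_tnth => i; rewrite tnth_mktuple; case: i => [[|[|i]] hi].
  have -> : mul_adjacent [tuple g; h; k] ord0 = [tuple (g * h)%g; k].
    by apply: eq_from_tnth => i; rewrite tnth_mktuple; case: i => [[|[|i]] hi].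
  have -> : mul_adjacent [tuple g; h; k] (lift ord0 ord0) = [tuple g; (h * k)%g].
    by apply: eq_from_tnth => i; rewrite tnth_mktuple; case: i => [[|[|i]] hi].
  rewrite -!/(w _ _) /bump !exprS !expr0; set s := (LHS in LHS = _).
  by move=> s0; have {s0} : s = 0%R := s0; rewrite /s; lra.
have wD g h : (`|w g h| <= D)%R by exact: fD.
have [h hD hE] := bounded_primitive_of_morphism wD
  (hqm_displacing_morphism (displacing_ext wC wD dis)
     (homogenization_hqm (ext_height_quasimorphism (wC := wC) wD))).
exists (fun t => h (tnth t ord0)); first by exists D => t; exact: hD.
apply/funext => t; pose t0 := tnth t ord0; pose t1 := tnth t (lift ord0 ord0).
have -> : f t = w t0 t1.
  by congr f; apply: eq_from_tnth; case=> [[|[|i]] hi] //;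
     rewrite ?(tnth_nth 1) /= /t0 /t1 (tnth_nth 1).
rewrite hE /coboundary big_ord_recl big_ord0 !tnth_mktuple /= -/t1.
have -> : widen_ord (leqnSn 1) ord0 = ord0 :> 'I_2 by exact: val_inj.
by rewrite -/t0 !exprS !expr0; lra.
Qed.

(** * Classes of triples written with trees and words in raw indices *)

Definition wordon n (w : seq (nat * bool)) := all (fun l => l.1.+1 < n) w.

Definition winv (w : seq (nat * bool)) := [seq (l.1, ~~ l.2) | l <- rev w].

Definition wshift m (w : seq (nat * bool)) := [seq ((m + l.1)%N, l.2) | l <- w].

Lemma wordon_nword n w : wordon n w -> exists w' : bword n, nword w' = w.
Proof.
elim: w => [_|[i e] w IHw /= /andP[lt_in /IHw[w' <-]]]; first by exists [::].
have lt_in' : i < n.-1 by lia.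
by exists ((Ordinal lt_in', e) :: w').
Qed.

Lemma wordonW m n w : m <= n -> wordon m w -> wordon n w.
Proof. by move=> mn; apply: sub_all => l; lia. Qed.

Lemma wordon_winv n w : wordon n (winv w) = wordon n w.
Proof. by rewrite /wordon all_map all_rev. Qed.

Lemma winvK : involutive winv.
Proof.
move=> w; rewrite /winv -map_rev revK -map_comp.
by rewrite map_id_in // => -[i e] _ /=; rewrite negbK.
Qed.

Lemma nbraid_winv n w : nbraid n (winv w) = (nbraid n w)^-1.
Proof.
elim: w => [|[i e] w IHw]; first by rewrite invg1.
rewrite /winv rev_cons map_rcons -cats1 nbraid_cat -/(winv w) IHw /= mulg1 invgM.
by congr (_ * _); rewrite /sige; case: e => //=; rewrite invgK.
Qed.

Lemma nrho_above n w k : wordon n w -> n <= k -> nrho w k = k.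
Proof.
elim: w => //= -[i e] w IHw /andP[/= lt_in /IHw IH] nk.
by rewrite IH //= /nswap; do !case: ifP; lia.
Qed.

Lemma ncable_above n w k : wordon n w -> n <= k -> ncable k w = w.
Proof.
elim: w => //= -[i e] w IHw /andP[/= lt_in rw] nk.
rewrite (nrho_above rw nk) IHw // /=; do !case: ifP => //=; lia.
Qed.

Lemma nrho_lt n w k : wordon n w -> k < n -> nrho w k < n.
Proof.
elim: w => //= -[i e] w IHw /andP[/= lt_in /IHw IH] /IH.
by rewrite /nswap; do !case: ifP; lia.
Qed.

Lemma wordon_ncable n w k : wordon n w -> wordon n.+1 (ncable k w).
Proof.
elim: w => //= -[i e] w IHw /andP[/= lt_in /IHw].
rewrite /wordon all_cat => ->; rewrite andbT.
by do !case: ifP => _ /=; rewrite ?andbT; lia.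
Qed.

Lemma nrho_wshift m w k : k < m -> nrho (wshift m w) k = k.
Proof.
move=> km; elim: w => //= -[i e] w -> /=.
by rewrite /nswap; do !case: ifP; lia.
Qed.

Lemma ncable_wshift m w k : k < m -> ncable k (wshift m w) = wshift m.+1 w.
Proof.
move=> km; elim: w => //= -[i e] w IHw; rewrite nrho_wshift // IHw /= ifT //.
lia.
Qed.

Lemma nbraid_wshiftC N n u w : wordon n u ->
  commute (nbraid N u) (nbraid N (wshift n w)).
Proof.
move=> ru; elim: w => [|[j f] w IHw] /=; first exact: commute1.
apply: commuteM => // {IHw}.
elim: u ru => [|[i e] u IHu] /= => [_|/andP[lt_in /IHu IH]].
  exact/commute_sym/commute1.
apply: commute_sym; apply: commuteM; last exact: commute_sym.
by apply/commute_sym/sige_far; move: lt_in => /=; lia.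
Qed.

(** A tree above [s] arises from [s] by adding carets one at a time, so that
    statements about expansions follow from the case of a single caret. *)
Lemma tle_ind (P : tree -> Prop) s t :
  (forall r k, k < nleaves r -> P r -> P (add_caret r k)) ->
  tle s t -> P s -> P t.
Proof.
move=> Padd; have [d] := ubnP (nleaves t - nleaves s).
elim: d s => // d IHd s ltd st Ps; have := tle_nleaves st.
rewrite leq_eqVlt => /predU1P[/(tle_eq st) <- //|lt_st].
have [k ks kt] := tle_add st lt_st.
by apply: (IHd (add_caret s k)) => //; rewrite ?nleaves_add_caret; [lia|exact: Padd].
Qed.

Lemma add_caret_ind (P : tree -> Prop) : P Leaf ->
  (forall r k, k < nleaves r -> P r -> P (add_caret r k)) -> forall t, P t.
Proof. by move=> P0 Padd t; exact: (tle_ind Padd _ P0). Qed.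

Lemma add_caretL a b k : k < nleaves a ->
  add_caret (Caret a b) k = Caret (add_caret a k) b.
Proof. by rewrite /= => ->. Qed.

Lemma add_caretR a b k :
  add_caret (Caret a b) (nleaves a + k) = Caret a (add_caret b k).
Proof. by rewrite /= ltnNge leq_addr addKn. Qed.

Definition treeN_of t : treeN (nleaves t) := Sub t (eqxx _).

(** The default of [insubd] is only reached when [t] and [u] have different
    numbers of leaves, in which case there is no such class.  Trees carry no
    leaf count here, which avoids casts between braid groups. *)
Definition bVel (t : tree) (w : seq (nat * bool)) (u : tree) : bV :=
  \pi_bV (Triple (treeN_of t) (nbraid (nleaves t) w) (insubd (treeN_of t) u)).

Lemma bVelE n (t u : treeN n) w :
  \pi_bV (Triple t (nbraid n w) u) = bVel (val t) w (val u).
Proof.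
case: t u => t tn [u un]; have tE := eqP tn; subst n.
rewrite /bVel; congr (\pi_bV (Triple _ _ _)); apply: val_inj => //.
by rewrite insubdK.
Qed.

Lemma bVelM t u v a b : nleaves t = nleaves u -> nleaves u = nleaves v ->
  bVel t a u * bVel u b v = bVel t (a ++ b) v.
Proof.
move=> /eqP tu /eqP; rewrite eq_sym => vu.
pose t' : treeN (nleaves u) := Sub t tu; pose v' : treeN (nleaves u) := Sub v vu.
rewrite -(bVelE t' (treeN_of u)) -(bVelE (treeN_of u) v') -(bVelE t' v').
by rewrite [_ * _]bV_mulE nbraid_cat.
Qed.

Lemma bVelV t u w : nleaves t = nleaves u -> (bVel t w u)^-1 = bVel u (winv w) t.
Proof.
move=> /eqP tu; pose t' : treeN (nleaves u) := Sub t tu.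
by rewrite -(bVelE t' (treeN_of u)) -(bVelE (treeN_of u) t') [LHS]bV_invE nbraid_winv.
Qed.

Lemma bVel1 t : bVel t [::] t = 1.
Proof. by rewrite -(bVelE (treeN_of t) (treeN_of t)) [RHS](bV_oneE (treeN_of t)). Qed.

Lemma bVel_expand t u w k : nleaves t = nleaves u -> wordon (nleaves u) w ->
  k < nleaves u ->
  bVel t w u = bVel (add_caret t (nrho w k)) (ncable k w) (add_caret u k).
Proof.
move=> /eqP tu /wordon_nword[w' <-] ku.
pose t' : treeN (nleaves u) := Sub t tu; pose k' : 'I_(nleaves u) := Ordinal ku.
rewrite -(bVelE t' (treeN_of u)) -pi_nword.
set x := Triple _ _ _.
rewrite (genquot_step (r := expands) (y := expansion x k')).
  by rewrite /expansion /= rho_pi cable_pi pi_nword bVelE nword_cable /= val_rho_word.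
by exists k'.
Qed.

Lemma bVel_hat t u w : nleaves t = nleaves u -> wordon (nleaves u).-1 w ->
  bVel t w u \in hat_bV.
Proof.
move=> /eqP tu rw; pose t' : treeN (nleaves u) := Sub t tu.
rewrite -(bVelE t' (treeN_of u)); apply: hat_bVP.
have [w' w'E] := wordon_nword (wordonW (leq_pred _) rw).
exists w'; last by rewrite pi_nword w'E.
by move: rw; rewrite -w'E /wordon all_map; apply: sub_all => l /=; lia.
Qed.

Lemma hat_bVel x : x \in hat_bV -> exists t u w,
  [/\ nleaves t = nleaves u, wordon (nleaves u).-1 w & x = bVel t w u].
Proof.
move=> /asboolP[n [t [u [b [[w hw ->] ->]]]]].
exists (val t), (val u), (nword w).
rewrite (eqP (valP t)) (eqP (valP u)); split=> //; last by rewrite pi_nword bVelE.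
by rewrite /wordon all_map; apply: sub_all hw => l /=; lia.
Qed.

(** * The subgroup supported on the left half *)

Definition left_supported (x : bV) := exists t u w,
  [/\ nleaves t = nleaves u, wordon (nleaves u) w
    & x = bVel (Caret t Leaf) w (Caret u Leaf)].

(** Adding carets to [u] only affects the first strands, hence preserves the shape
    of the class.  This makes any two left supported classes composable
    within this shape. *)
Lemma left_supported_growR t u w u' :
  nleaves t = nleaves u -> wordon (nleaves u) w -> tle u u' ->
  exists t' w', [/\ nleaves t' = nleaves u', wordon (nleaves u') w'
    & bVel (Caret t Leaf) w (Caret u Leaf) = bVel (Caret t' Leaf) w' (Caret u' Leaf)].
Proof.
move=> tu rw uu'; set x := bVel _ _ _; pose P u' := exists t' w',
  [/\ nleaves t' = nleaves u', wordon (nleaves u') w'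
    & x = bVel (Caret t' Leaf) w' (Caret u' Leaf)].
apply: (tle_ind (P := P) _ uu'); last by exists t, w.
move=> r k kr [t' [w' [t'r rw' xE]]].
exists (add_caret t' (nrho w' k)), (ncable k w').
rewrite !nleaves_add_caret t'r; split=> //; first exact: wordon_ncable.
rewrite xE (bVel_expand (k := k)) /= ?t'r //; try lia.
  by rewrite nrho_lt // kr.
by apply: wordonW rw'; lia.
Qed.

Lemma left_supportedV x : left_supported x -> left_supported x^-1.
Proof.
move=> [t [u [w [tu rw ->]]]]; exists u, t, (winv w).
by rewrite wordon_winv tu bVelV //= tu.
Qed.

Lemma left_supportedM x y : left_supported x -> left_supported y ->
  left_supported (x * y).
Proof.
move=> [t [u [w [tu rw ->]]]] [v [z [b [vz rb ->]]]].
have [t' [w' [tu' rw' ->]]] := left_supported_growR tu rw (tle_joinl u v).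
rewrite -[X in _ * X]invgK bVelV /= ?vz //.
have rb1 : wordon (nleaves v) (winv b) by rewrite wordon_winv vz.
have [z' [b' [zv' rb' ->]]] := left_supported_growR (esym vz) rb1 (tle_joinr u v).
rewrite bVelV /= ?zv' // bVelM /= ?tu' ?zv' //.
exists t', z', (w' ++ winv b'); rewrite tu' zv'; split=> //.
by rewrite /wordon all_cat -!/(wordon _ _) wordon_winv rw' rb'.
Qed.

Lemma left_supported_hat x : left_supported x -> x \in hat_bV.
Proof.
move=> [t [u [w [tu rw ->]]]]; apply: bVel_hat => /=; first by rewrite tu.
by rewrite addn1.
Qed.

Lemma left_supported_split t u w : nleaves t = nleaves u -> wordon (nleaves u) w ->
  bVel (Caret t Leaf) w (Caret u Leaf) =
  bVel (Caret t (Caret Leaf Leaf)) w (Caret u (Caret Leaf Leaf)).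
Proof.
move=> tu rw; rewrite (bVel_expand (k := nleaves u)) /= ?tu ?addn1 //.
  by rewrite (nrho_above rw) // (ncable_above rw) // ltnn.
by apply: wordonW rw.
Qed.

(** A generator of Thompson's group F; conjugation by it moves the left half onto
    the left quarter. *)
Definition squeeze : bV :=
  bVel (Caret Leaf (Caret Leaf Leaf)) [::] (Caret (Caret Leaf Leaf) Leaf).

(** Along a trivial braid, expansion adds carets at the same leaves on both
    sides. *)
Lemma squeezeE a b c :
  squeeze = bVel (Caret a (Caret b c)) [::] (Caret (Caret a b) c).
Proof.
have grow t u k : nleaves t = nleaves u -> k < nleaves u ->
    bVel t [::] u = bVel (add_caret t k) [::] (add_caret u k).
  by move=> tu ku; rewrite (bVel_expand (k := k)).
have -> : squeeze = bVel (Caret a (Caret Leaf Leaf)) [::] (Caret (Caret a Leaf) Leaf).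
  elim/add_caret_ind: a => // a k ka ->.
  rewrite (grow _ _ k) /= ?ka; try lia.
  by rewrite ifT; last lia.
have -> : bVel (Caret a (Caret Leaf Leaf)) [::] (Caret (Caret a Leaf) Leaf) =
    bVel (Caret a (Caret b Leaf)) [::] (Caret (Caret a b) Leaf).
  elim/add_caret_ind: b => // b k kb ->.
  rewrite (grow _ _ (nleaves a + k)%N); try by rewrite /=; lia.
  rewrite add_caretR (add_caretL (a := b)) // (add_caretL (a := Caret a b)).
    by rewrite add_caretR.
  by rewrite /=; lia.
elim/add_caret_ind: c => // c k kc ->.
rewrite (grow _ _ (nleaves a + (nleaves b + k))%N); try by rewrite /=; lia.
rewrite 2!add_caretR addnA -[(nleaves a + nleaves b)%N]/(nleaves (Caret a b)).
by rewrite add_caretR.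
Qed.

Lemma squeezeJ t u w : nleaves t = nleaves u -> wordon (nleaves u) w ->
  bVel (Caret t Leaf) w (Caret u Leaf) ^ squeeze =
  bVel (Caret (Caret t Leaf) Leaf) w (Caret (Caret u Leaf) Leaf).
Proof.
move=> tu rw; rewrite left_supported_split // conjgE.
rewrite {1}(squeezeE t Leaf Leaf) (squeezeE u Leaf Leaf) bVelV; last by rewrite /=; lia.
by rewrite !bVelM /= ?cats0 //; lia.
Qed.

(** The tree [s] hangs at a strand that the braid of [x ^ squeeze] does not
    involve; it makes room for the support of another class. *)
Lemma squeezeJ_grow t u w s : nleaves t = nleaves u -> wordon (nleaves u) w ->
  bVel (Caret t Leaf) w (Caret u Leaf) ^ squeeze =
  bVel (Caret (Caret t s) Leaf) w (Caret (Caret u s) Leaf).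
Proof.
move=> tu rw; rewrite squeezeJ //; elim/add_caret_ind: s => // s k ks ->.
rewrite (bVel_expand (k := (nleaves u + k)%N)); try by rewrite /=; lia.
  rewrite (nrho_above rw) ?leq_addr // (ncable_above rw) ?leq_addr //.
  rewrite (add_caretL (a := Caret t s)) ?(add_caretL (a := Caret u s)) /=; try lia.
  by rewrite -!/(add_caret (Caret _ _) _) add_caretR -tu add_caretR.
by apply: wordonW rw; rewrite /=; lia.
Qed.

(** One strand, at the bottom left, passing across [n] parallel strands to the top
    right: the first crossing with its second strand replaced by [n] copies. *)
Fixpoint crossing n := if n is n'.+1 then (n', true) :: crossing n' else [::].

Lemma wordon_crossing n : wordon n.+1 (crossing n).
Proof. by elim: n => //= n IHn; rewrite ltnSn; exact: wordonW IHn. Qed.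

Lemma nrho_crossing n k : k < n -> nrho (crossing n) k.+1 = k.
Proof.
elim: n k => //= n IHn k; rewrite ltnS leq_eqVlt => /predU1P[->|kn].
  by rewrite (nrho_above (wordon_crossing n)) // /nswap; do !case: ifP; lia.
by rewrite IHn // /nswap; do !case: ifP; lia.
Qed.

Lemma ncable_crossing n k : k < n -> ncable k.+1 (crossing n) = crossing n.+1.
Proof.
elim: n k => // n IHn k; rewrite ltnS leq_eqVlt => /predU1P[->|kn].
  rewrite [LHS]/= (ncable_above (wordon_crossing n)) //.
  by rewrite (nrho_above (wordon_crossing n)) //; do !case: ifP; rewrite //=; lia.
rewrite [LHS]/= IHn // nrho_crossing // kn //.
Qed.

Lemma crossing_far N n j : n < j -> commute (sig N j) (nbraid N (crossing n)).
Proof.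
move=> nj; elim: n nj => [|n IHn] nj /=; first exact: commute1.
by apply: commuteM; [apply/commute_sym/sig_far; lia|apply: IHn; lia].
Qed.

(** A crossing of two parallel strands slides along the strand that passes both;
    this is the braid relation. *)
Lemma sig_crossing N n i : i.+1 < n -> n < N ->
  sig N i * nbraid N (crossing n) = nbraid N (crossing n) * sig N i.+1.
Proof.
elim: n => // n IHn; rewrite ltnS leq_eqVlt => /predU1P[<-|lt_in] nN /=.
  have C := crossing_far N (ltnSn i); rewrite /sige /= -!mulgA.
  by rewrite -C sig_nearC //; lia.
by rewrite /= /sige sig_farC // IHn ?mulgA //; lia.
Qed.

Lemma nbraid_crossing N n w : wordon n w -> n < N ->
  nbraid N w * nbraid N (crossing n) = nbraid N (crossing n) * nbraid N (wshift 1 w).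
Proof.
elim: w => [|[i e] w IHw] /=; first by rewrite mul1g mulg1.
move=> /andP[/= lt_in /IHw IH] nN; rewrite -mulgA IH // !mulgA; congr (_ * _).
have E := sig_crossing lt_in nN; rewrite add1n /sige; case: e => //.
by apply: (mulgI (sig N i)); rewrite !mulgA mulgV mul1g E mulgK.
Qed.

(** The tree pair of [squeeze], with a crossing that exchanges the two quarters of
    the left half: conjugation by it moves the left half onto the second quarter. *)
Definition swap : bV :=
  bVel (Caret Leaf (Caret Leaf Leaf)) [:: (0%N, true)] (Caret (Caret Leaf Leaf) Leaf).

Lemma swapE t : swap =
  bVel (Caret t (Caret Leaf Leaf)) (crossing (nleaves t)) (Caret (Caret Leaf t) Leaf).
Proof.
elim/add_caret_ind: t => // t k kt ->.
rewrite (bVel_expand (k := k.+1)) /=; try lia.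
  rewrite nrho_crossing // ncable_crossing // kt nleaves_add_caret ifT; last lia.
  by rewrite subn1.
by apply: wordonW (wordon_crossing _); lia.
Qed.

Lemma swapJ t u w : nleaves t = nleaves u -> wordon (nleaves u) w ->
  bVel (Caret t Leaf) w (Caret u Leaf) ^ swap =
  bVel (Caret (Caret Leaf t) Leaf) (wshift 1 w) (Caret (Caret Leaf u) Leaf).
Proof.
move=> tu rw; rewrite left_supported_split // conjgE.
rewrite {1}(swapE t) (swapE u) bVelV; last by rewrite /=; lia.
rewrite !bVelM /= ?tu; try lia.
rewrite /bVel !nbraid_cat nbraid_winv.
rewrite nbraid_crossing //; last by rewrite /=; lia.
by rewrite mulKg.
Qed.

Lemma swapJ_grow t u w s : nleaves t = nleaves u -> wordon (nleaves u) w ->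
  bVel (Caret t Leaf) w (Caret u Leaf) ^ swap =
  bVel (Caret (Caret s t) Leaf) (wshift (nleaves s) w) (Caret (Caret s u) Leaf).
Proof.
move=> tu rw; rewrite swapJ //; elim/add_caret_ind: s => // s k ks ->.
rewrite (bVel_expand (k := k)) /=; try lia.
  by rewrite nrho_wshift // ncable_wshift // nleaves_add_caret ks !ifT; try lia.
by rewrite /wordon all_map; apply: sub_all rw => l /=; lia.
Qed.

Lemma squeeze_swap_commute x y : left_supported x -> left_supported y ->
  commute (x ^ squeeze) (y ^ swap).
Proof.
move=> [t [u [w [tu rw ->]]]] [t' [u' [w' [tu' rw' ->]]]].
rewrite /commute {1}(squeezeJ_grow t') // {1}(swapJ_grow u) //.
rewrite (swapJ_grow t) // (squeezeJ_grow u') // !bVelM /=; try lia.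
by rewrite /bVel !nbraid_cat tu (nbraid_wshiftC _ _ rw).
Qed.

Lemma left_supported_squeeze x : left_supported x -> left_supported (x ^ squeeze).
Proof.
move=> [t [u [w [tu rw ->]]]]; exists (Caret t Leaf), (Caret u Leaf), w.
rewrite squeezeJ //= tu; split=> //; apply: wordonW rw; lia.
Qed.

Lemma left_supported_swap x : left_supported x -> left_supported (x ^ swap).
Proof.
move=> [t [u [w [tu rw ->]]]]; exists (Caret Leaf t), (Caret Leaf u), (wshift 1 w).
rewrite swapJ //= tu; split=> //.
by rewrite /wordon all_map; apply: sub_all rw => l /=; lia.
Qed.

(** Each multiplication by [squeeze] undoes one rotation of the tree and thereby
    lengthens its rightmost branch by one; an induction on the right subtree
    reduces that branch to a single leaf. *)
Lemma squeezeX_comb t2 t1 : exists a t, (nleaves t).+1 = (nleaves t1 + nleaves t2)%N /\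
  forall w u, nleaves u = (nleaves t).+1 ->
    bVel (Caret t1 t2) w u = squeeze ^+ a * bVel (Caret t Leaf) w u.
Proof.
elim: t2 t1 => [|b _ c IHc] t1.
  by exists 0%N, t1; rewrite /= addn1; split=> // w u _; rewrite mul1g.
have [a [t [tE elt]]] := IHc (Caret t1 b); exists a.+1, t.
rewrite /= in tE *; split=> [|w u uE]; first lia.
rewrite expgS -mulgA -elt // (squeezeE t1 b c) bVelM //=; lia.
Qed.

(** Since the braid fixes the last strand, shortening the rightmost branches of both
    trees leaves a left supported class. *)
Lemma hat_exhaust x : x \in hat_bV -> exists a b y,
  left_supported y /\ x = squeeze ^+ a * y * squeeze ^- b.
Proof.
move=> /hat_bVel[[|t1 t2] [[|u1 u2] [w [/= tu rw ->]]]].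
(* With a single leaf there are no crossings, and the class is trivial. *)
- exists 0%N, 0%N, (bVel (Caret Leaf Leaf) w (Caret Leaf Leaf)).
  rewrite expg0 mul1g invg1 mulg1; case: w rw => // _; split; first by exists Leaf, Leaf, [::].
  by rewrite !bVel1.
- by have := nleaves_gt0 u1; have := nleaves_gt0 u2; lia.
- by have := nleaves_gt0 t1; have := nleaves_gt0 t2; lia.
have [a [t [tE elt]]] := squeezeX_comb t2 t1.
have [b [u [uE elu]]] := squeezeX_comb u2 u1.
exists a, b, (bVel (Caret t Leaf) w (Caret u Leaf)); split.
  by exists t, u, w; split=> //; [lia|move: rw; rewrite -uE].
rewrite elt /=; last lia.
rewrite -mulgA; congr (_ * _).
rewrite -[w]winvK -bVelV /=; last lia.
rewrite elu /=; last lia.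
by rewrite invgM bVelV /=; last lia.
Qed.

Fact squeeze_hat : squeeze \in hat_bV. Proof. exact: bVel_hat. Qed.
Fact swap_hat : swap \in hat_bV. Proof. exact: bVel_hat. Qed.

Lemma displacing_hatbV : displacing (G := hatbV) (fun x => left_supported (val x))
  (Sub squeeze squeeze_hat) (Sub swap swap_hat).
Proof.
split=> [x y|x|x|x|x y|x].
- by rewrite gmulfM; exact: left_supportedM.
- by rewrite gmulfV; exact: left_supportedV.
- by rewrite gmulfJ; exact: left_supported_squeeze.
- by rewrite gmulfJ; exact: left_supported_swap.
- move=> Bx By; apply: val_inj; rewrite [LHS]gmulfM [RHS]gmulfM !gmulfJ.
  exact: squeeze_swap_commute.
have [a [b [y [By xE]]]] := hat_exhaust (valP x).
exists a, b, (Sub y (left_supported_hat By)); split; first exact: By.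
by apply: val_inj; rewrite xE 2!gmulfM gmulfV !gmulfXn.
Qed.

Theorem theorem1p2 (R : realType) (c : Hb R hatbV 2) : c = 0%R.
Proof. exact: displacing_Hb2_eq0 displacing_hatbV c. Qed.
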